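(* Let $\mathbb{G}$ be a discrete quantum group, let $P\in\ell^\infty(\mathbb{G})$ be a group-like projection, and let $\widetilde{N}_P=\{x\in\ell^\infty(\mathbb{G}):(1\otimes P)\Delta_{\mathbb{G}}(x)=x\otimes P\}$ be the associated right coideal. Then $\widetilde{N}_P$ is relatively amenable if and only if there exists a $P$-left invariant state $\ell^\infty(\mathbb{G})\to\mathbb{C}$.
   Context: $\mathbb{G}$ has von Neumann algebra $\ell^\infty(\mathbb{G})$, coproduct $\Delta_{\mathbb{G}}$ and predual $\ell^1(\mathbb{G})$, a unital Banach algebra under convolution $f*g=(f\otimes g)\Delta_{\mathbb{G}}$. For $x\in\ell^\infty(\mathbb{G})$, $f\in\ell^1(\mathbb{G})$, $m\in\ell^\infty(\mathbb{G})^*$: the right module action is $x*f=(f\otimes\mathrm{id})\Delta_{\mathbb{G}}(x)$, and $f*m\in\ell^\infty(\mathbb{G})^*$ is $(f*m)(x)=m(x*f)$. For $y\in\ell^\infty(\mathbb{G})$, $(yf)(x)=f(xy)$ and $(fy)(x)=f(yx)$. A group-like projection is a self-adjoint projection $P\in\ell^\infty(\mathbb{G})$ with $(1\otimes P)\Delta_{\mathbb{G}}(P)=P\otimes P$. A right coideal is a von Neumann subalgebra $N\subseteq\ell^\infty(\mathbb{G})$ with $x*f\in N$ for all $x\in N$, $f\in\ell^1(\mathbb{G})$. A right coideal $N$ is relatively amenable if there is a unital completely positive right $\ell^1(\mathbb{G})$-module map $\ell^\infty(\mathbb{G})\to N$. A functional $m\in\ell^\infty(\mathbb{G})^*$ is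 $P$-left invariant if either $(fP)*m=f(P)m$ for every $f\in\ell^1(\mathbb{G})$, or $(Pf)*m=f(P)m$ for every $f\in\ell^1(\mathbb{G})$. *)

(* Defs.v *)
From HB Require Import structures.
From mathcomp Require Import all_boot all_order all_algebra finmap.
From mathcomp Require Import complex mxtens ring.
From mathcomp Require Import boolp classical_sets reals ereal esum.

Set Implicit Arguments.
Unset Strict Implicit.
Unset Printing Implicit Defensive.
Import Order.TTheory GRing.Theory Num.Theory.
Local Open Scope ring_scope.
Local Notation "x %:C" := (real_complex _ x) : ring_scope.

Section Matrices.
Variable R : realType.
Notation C := R[i].

Definition adjmx m n (A : 'M[C]_(m, n)) : 'M[C]_(n, m) := map_mx Num.conj A^T.

Definition sqnorm n (u : 'cV[C]_n) : C := \sum_k `|u k 0| ^+ 2.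

(* For [0 <= c]: the operator norm of [A] on the Hilbert space C^n is <= c. *)
Definition opnorm_le n (A : 'M[C]_n) (c : R) : Prop :=
  forall u : 'cV[C]_n, sqnorm (A *m u) <= (c ^+ 2)%:C * sqnorm u.

(* The norm of the functional [tr (t _)] on M_n, i.e. the trace norm of [t],
   is <= c. *)
Definition trnorm_le n (t : 'M[C]_n) (c : R) : Prop :=
  forall A : 'M[C]_n, opnorm_le A 1 -> `|\tr (t *m A)| <= c%:C.

Definition posdefmx n (h : 'M[C]_n) : Prop :=
  forall u : 'cV[C]_n, u != 0 -> 0 < (adjmx u *m h *m u) 0 0.

Lemma sqnorm_ge0 n (u : 'cV[C]_n) : 0 <= sqnorm u.
Proof. by apply: sumr_ge0 => k _; rewrite exprn_ge0. Qed.

Lemma realC_ge0 (c : R) : (0 <= c%:C :> C) = (0 <= c).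
Proof. by rewrite -(rmorph0 (real_complex R)) lecR. Qed.

Lemma sqnorm_real n (u : 'cV[C]_n) : sqnorm u = (complex.Re (sqnorm u))%:C.
Proof. by rewrite RRe_real // ger0_real // sqnorm_ge0. Qed.

Lemma Re_sqnorm_ge0 n (u : 'cV[C]_n) : 0 <= complex.Re (sqnorm u).
Proof. by rewrite -realC_ge0 -sqnorm_real sqnorm_ge0. Qed.

Lemma opnorm_le_sqrt n (A : 'M[C]_n) (K : R) : 0 <= K ->
  (forall u, sqnorm (A *m u) <= K%:C * sqnorm u) -> opnorm_le A (Num.sqrt K).
Proof. by move=> K0 h u; rewrite sqr_sqrtr. Qed.

Lemma normsqrD (x y : C) : `|x + y| ^+ 2 <= 2 * (`|x| ^+ 2 + `|y| ^+ 2).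
Proof.
rewrite -subr_ge0.
suff -> : 2 * (`|x| ^+ 2 + `|y| ^+ 2) - `|x + y| ^+ 2 = `|x - y| ^+ 2.
  by rewrite exprn_ge0.
by rewrite !normCK !rmorphB !rmorphD /=; ring.
Qed.

Lemma sqnormD n (u v : 'cV[C]_n) :
  sqnorm (u + v) <= 2 * (sqnorm u + sqnorm v).
Proof.
rewrite /sqnorm -big_split mulr_sumr; apply: ler_sum => k _ /=.
by rewrite mxE normsqrD.
Qed.

Lemma sqnormZ n (a : C) (u : 'cV[C]_n) : sqnorm (a *: u) = `|a| ^+ 2 * sqnorm u.
Proof.
by rewrite /sqnorm mulr_sumr; apply: eq_bigr => k _; rewrite mxE normrM exprMn.
Qed.

Lemma adjmxK m n (A : 'M[C]_(m, n)) : adjmx (adjmx A) = A.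
Proof. by apply/matrixP => i j; rewrite !mxE conjCK. Qed.

Lemma adjmxM m n p (A : 'M[C]_(m, n)) (B : 'M[C]_(n, p)) :
  adjmx (A *m B) = adjmx B *m adjmx A.
Proof. by rewrite /adjmx trmx_mul map_mxM. Qed.

Lemma sqnormE n (u : 'cV[C]_n) : sqnorm u = (adjmx u *m u) 0 0.
Proof.
by rewrite !mxE; apply: eq_bigr => k _; rewrite !mxE normCK mulrC.
Qed.

Lemma CauchySchwarz_sum (I : finType) (a b : I -> C) :
  `|\sum_k (a k)^* * b k| ^+ 2 <=
  (\sum_k `|a k| ^+ 2) * (\sum_k `|b k| ^+ 2).
Proof.
set A := \sum_k `|a k| ^+ 2; set B := \sum_k `|b k| ^+ 2.
set s := \sum_k _.
have A0 : 0 <= A by apply: sumr_ge0 => k _; rewrite exprn_ge0.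
have [A_eq0|An0] := eqVneq A 0.
  have a0 k : a k = 0.
    apply/eqP; rewrite -normr_eq0 -sqrf_eq0; apply/eqP.
    by have /psumr_eq0P := A_eq0; apply=> // i _; rewrite exprn_ge0.
  rewrite /s big1 ?normr0 ?expr0n ?A_eq0 ?mul0r //.
  by move=> k _; rewrite a0 rmorph0 mul0r.
have : 0 <= \sum_k `|A * b k - s * a k| ^+ 2.
  by apply: sumr_ge0 => k _; rewrite exprn_ge0.
have AJ : A^* = A by apply/eqP; rewrite -CrealE ger0_real.
have -> : \sum_k `|A * b k - s * a k| ^+ 2 = A * (A * B - `|s| ^+ 2).
  under eq_bigr => k _.
    have -> : `|A * b k - s * a k| ^+ 2 =
      A ^+ 2 * `|b k| ^+ 2 - A * s^* * ((a k)^* * b k)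
        - A * s * ((a k)^* * b k)^* + `|s| ^+ 2 * `|a k| ^+ 2.
      by rewrite !normCK !rmorphB !rmorphM /= conjCK AJ; ring.
    over.
  rewrite !big_split /= !sumrN -!mulr_sumr -rmorph_sum -/s -/A -/B normCK /=.
  by ring.
by rewrite pmulr_rge0 ?subr_ge0 // lt_def An0.
Qed.


Lemma dot_sqnorm n (u v : 'cV[C]_n) :
  `|(adjmx u *m v) 0 0| ^+ 2 <= sqnorm u * sqnorm v.
Proof.
rewrite mxE; under eq_bigr => k _ do rewrite !mxE.
exact: (CauchySchwarz_sum (fun k => u k 0) (fun k => v k 0)).
Qed.

Lemma opnorm_le_form n (A : 'M[C]_n) (c : R) :
  (forall u v, `|(adjmx v *m A *m u) 0 0| ^+ 2
     <= (c ^+ 2)%:C * (sqnorm v * sqnorm u)) -> opnorm_le A c.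
Proof.
move=> h u; have := h u (A *m u); rewrite -mulmxA -sqnormE.
rewrite ger0_norm ?sqnorm_ge0 // expr2 mulrCA.
have [-> _|n0] := eqVneq (sqnorm (A *m u)) 0.
  by rewrite mulr_ge0 ?sqnorm_ge0 // realC_ge0 sqr_ge0.
by rewrite ler_pM2l // lt_def n0 sqnorm_ge0.
Qed.

Lemma opnorm_le_adj n (A : 'M[C]_n) c : opnorm_le A c -> opnorm_le (adjmx A) c.
Proof.
move=> hA; apply: opnorm_le_form => u v.
rewrite -[adjmx v *m adjmx A]adjmxM; apply: (le_trans (dot_sqnorm _ _)).
by rewrite mulrA ler_wpM2r ?sqnorm_ge0 ?hA.
Qed.

Lemma opnorm_leM n (A B : 'M[C]_n) a b :
  opnorm_le A a -> opnorm_le B b -> opnorm_le (A *m B) (a * b).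
Proof.
move=> hA hB u; rewrite -mulmxA exprMn rmorphM /= -mulrA.
by apply: (le_trans (hA _)); rewrite ler_wpM2l ?realC_ge0 ?sqr_ge0 ?hB.
Qed.

Lemma opnorm_le1 n : opnorm_le (1%:M : 'M[C]_n) 1.
Proof. by move=> u; rewrite mul1mx expr1n rmorph1 mul1r. Qed.

Lemma opnorm_leD n (A B : 'M[C]_n) a b : opnorm_le A a -> opnorm_le B b ->
  opnorm_le (A + B) (Num.sqrt (2 * (a ^+ 2 + b ^+ 2))).
Proof.
move=> hA hB; apply: opnorm_le_sqrt => [|u].
  by rewrite mulr_ge0 ?addr_ge0 ?sqr_ge0.
rewrite mulmxDl; apply: (le_trans (sqnormD _ _)).
have -> : (2 * (a ^+ 2 + b ^+ 2))%:C = 2 * ((a ^+ 2)%:C + (b ^+ 2)%:C) :> C.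
  by rewrite !mulr_natl rmorphMn rmorphD.
rewrite -mulrA ler_pM2l ?ltr0n // mulrDl.
exact: lerD.
Qed.

Lemma opnorm_leZ n (A : 'M[C]_n) (z : C) a : opnorm_le A a ->
  opnorm_le (z *: A) (complex.Re `|z| * a).
Proof.
move=> hA u; rewrite -scalemxAl sqnormZ.
have -> : ((complex.Re `|z| * a) ^+ 2)%:C = `|z| ^+ 2 * (a ^+ 2)%:C :> C.
  by rewrite exprMn rmorphM; congr (_ * _); rewrite [LHS]rmorphXn; congr (_ ^+ 2); apply: RRe_real; rewrite normr_real.
by rewrite -[leRHS]mulrA ler_wpM2l ?exprn_ge0 ?hA.
Qed.

(* Matrices indexed by pairs: [h] is [mxtens_index] or its flip. *)
Section Pairs.
Variables (m p N : nat) (h : 'I_m * 'I_p -> 'I_N).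
Hypothesis h_bij : bijective h.

Lemma sqnorm_pair (w : 'cV[C]_N) :
  sqnorm w = \sum_a \sum_b `|w (h (a, b)) 0| ^+ 2.
Proof.
rewrite pair_big /= /sqnorm (reindex h) /=; last exact: onW_bij.
by apply: eq_bigr => -[].
Qed.

Lemma mulmx_pair (X : 'M[C]_N) (w : 'cV[C]_N) i :
  (X *m w) i 0 = \sum_a \sum_b X i (h (a, b)) * w (h (a, b)) 0.
Proof.
rewrite pair_big /= mxE (reindex h) /=; last exact: onW_bij.
by apply: eq_bigr => -[].
Qed.

Lemma sqnorm_slice (X : 'M[C]_N) c (v u : 'cV[C]_p) (w : 'cV[C]_m) :
  opnorm_le X c ->
  sqnorm ((\matrix_(a, a') \sum_b \sum_b'
            (v b 0)^* * X (h (a, b)) (h (a', b')) * u b' 0) *m w)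
  <= (c ^+ 2)%:C * (sqnorm v * sqnorm u) * sqnorm w.
Proof.
move=> hX; have [g hK gK] := h_bij.
pose z : 'cV[C]_N := \col_k (w (g k).1 0 * u (g k).2 0).
have zE a b : z (h (a, b)) 0 = w a 0 * u b 0 by rewrite mxE hK.
have zN : sqnorm z = sqnorm w * sqnorm u.
  rewrite sqnorm_pair /sqnorm mulr_suml; apply: eq_bigr => a _.
  by rewrite mulr_sumr; apply: eq_bigr => b _; rewrite zE normrM exprMn.
have -> : (\matrix_(a, a') \sum_b \sum_b'
            (v b 0)^* * X (h (a, b)) (h (a', b')) * u b' 0) *m w =
          \col_a \sum_b (v b 0)^* * (X *m z) (h (a, b)) 0.
  apply/colP => a; rewrite !mxE.
  under eq_bigr => a' _ do rewrite mxE mulr_suml.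
  rewrite exchange_big /=; apply: eq_bigr => b _.
  rewrite mulmx_pair mulr_sumr; apply: eq_bigr => a' _.
  rewrite mulr_suml mulr_sumr; apply: eq_bigr => b' _.
  by rewrite zE; ring.
have -> : (c ^+ 2)%:C * (sqnorm v * sqnorm u) * sqnorm w
        = sqnorm v * ((c ^+ 2)%:C * sqnorm z) by rewrite zN; ring.
apply: (@le_trans _ _ (sqnorm v * sqnorm (X *m z))); last first.
  by rewrite ler_wpM2l ?sqnorm_ge0 ?hX.
rewrite (sqnorm_pair (X *m z)) mulr_sumr {1}/sqnorm; apply: ler_sum => a _.
rewrite mxE.
exact: (CauchySchwarz_sum (fun b => v b 0) (fun b => (X *m z) (h (a, b)) 0)).
Qed.

Lemma opnorm_le_entry (X : 'M[C]_N) c b b' : opnorm_le X c ->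
  opnorm_le (\matrix_(a, a') X (h (a, b)) (h (a', b'))) c.
Proof.
move=> hX w.
have dE k : sqnorm (delta_mx k 0 : 'cV[C]_p) = 1.
  rewrite /sqnorm (bigD1 k) //= big1 ?addr0.
    by rewrite mxE !eqxx normr1 expr1n.
  by move=> i /negPf ik; rewrite mxE ik normr0 expr0n.
have := sqnorm_slice (delta_mx b 0) (delta_mx b' 0) w hX.
rewrite !dE !mulr1; congr (sqnorm (_ *m w) <= _).
apply/matrixP => a a'; rewrite !mxE (bigD1 b) //= [X in _ + X]big1 ?addr0.
  rewrite (bigD1 b') //= big1 ?addr0; first by rewrite !mxE !eqxx rmorph1 mul1r mulr1.
  by move=> i /negPf ib; rewrite !mxE ib mulr0.
by move=> i /negPf ib; rewrite big1 // => k _; rewrite !mxE ib rmorph0 !mul0r.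
Qed.
End Pairs.

Lemma opnorm_le_tens m p (A : 'M[C]_m) (B : 'M[C]_p) a b :
  opnorm_le A a -> opnorm_le B b -> opnorm_le (A *t B) (a * b).
Proof.
move=> hA hB w.
have tb : bijective (@mxtens_index m p).
  by exists (@mxtens_unindex m p); [exact: mxtens_indexK | exact: mxtens_unindexK].
pose y (k : 'I_m) : 'cV[C]_p := \col_l w (mxtens_index (k, l)) 0.
pose z (l : 'I_p) : 'cV[C]_m := \col_k (B *m y k) l 0.
have wE k l : ((A *t B) *m w) (mxtens_index (k, l)) 0 = (A *m z l) k 0.
  rewrite (mulmx_pair tb) mxE; apply: eq_bigr => k' _.
  rewrite !mxE mulr_sumr; apply: eq_bigr => l' _.
  by rewrite tensmxE !mxE mulrA.
rewrite (sqnorm_pair tb) exchange_big /=.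
have -> : \sum_l \sum_k `|((A *t B) *m w) (mxtens_index (k, l)) 0| ^+ 2
        = \sum_l sqnorm (A *m z l).
  by apply: eq_bigr => l _; apply: eq_bigr => k _; rewrite wE.
apply: (@le_trans _ _ (\sum_l (a ^+ 2)%:C * sqnorm (z l))).
  by apply: ler_sum => l _; exact: hA.
rewrite -mulr_sumr.
have -> : ((a * b) ^+ 2)%:C * sqnorm w = (a ^+ 2)%:C * ((b ^+ 2)%:C * sqnorm w).
  by rewrite exprMn rmorphM mulrA.
rewrite ler_wpM2l ?realC_ge0 ?sqr_ge0 //.
have -> : \sum_l sqnorm (z l) = \sum_k sqnorm (B *m y k).
  rewrite exchange_big /=; apply: eq_bigr => k _; apply: eq_bigr => l _.
  by rewrite mxE.
rewrite (sqnorm_pair tb) mulr_sumr; apply: ler_sum => k _.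
apply: (le_trans (hB _)); rewrite le_eqVlt; apply/orP; left; apply/eqP.
by congr (_ * _); apply: eq_bigr => l _; rewrite mxE.
Qed.
End Matrices.

(* l^infty-direct sum of the matrix algebras M_(d i)(C), i in I. *)
Record linf (R : realType) (I : choiceType) (d : I -> nat) := Linf {
  blk :> forall i, 'M[R[i]]_(d i);
  linf_bounded : exists c : R, 0 <= c /\ forall i, opnorm_le (blk i) c }.

HB.instance Definition _ (R : realType) (I : choiceType) (d : I -> nat) :=
  gen_eqMixin (linf R d).
HB.instance Definition _ (R : realType) (I : choiceType) (d : I -> nat) :=
  gen_choiceMixin (linf R d).

Section Linf.
Variables (R : realType) (I : choiceType) (d : I -> nat).
Notation C := R[i].
Notation M := (linf R d).
Implicit Types x y : M.

Lemma linfP x y : (forall i, x i = y i) -> x = y.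
Proof.
case: x y => [x hx] [y hy] /= h.
have e : x = y by apply: functional_extensionality_dep.
by case: y / e hy {h} => hy; congr Linf; exact: Prop_irrelevance.
Qed.

Lemma linf_bound0 : exists c : R, 0 <= c /\
  forall i, opnorm_le (0 : 'M[C]_(d i)) c.
Proof.
exists 0; split=> // i u; rewrite mul0mx expr0n mul0r.
by rewrite /sqnorm big1 // => k _; rewrite mxE normr0 expr0n.
Qed.
Lemma linf_bound1 : exists c : R, 0 <= c /\
  forall i, opnorm_le (1%:M : 'M[C]_(d i)) c.
Proof. by exists 1; split=> // i; exact: opnorm_le1. Qed.
Lemma linf_boundZ a x : exists c : R, 0 <= c /\
  forall i, opnorm_le (a *: x i) c.
Proof.
have [c [c0 hc]] := linf_bounded x; exists (complex.Re `|a| * c).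
split=> [|i]; last exact: opnorm_leZ.
by rewrite mulr_ge0 // -realC_ge0 [X in 0 <= X]RRe_real ?normr_real.
Qed.
Lemma linf_boundN x : exists c : R, 0 <= c /\ forall i, opnorm_le (- x i) c.
Proof.
have [c [c0 hc]] := linf_boundZ (-1) x.
by exists c; split=> // i; rewrite -scaleN1r.
Qed.
Lemma linf_boundD x y : exists c : R, 0 <= c /\
  forall i, opnorm_le (x i + y i) c.
Proof.
have [c [c0 hc]] := linf_bounded x; have [b [b0 hb]] := linf_bounded y.
eexists; split; last by move=> i; exact: opnorm_leD.
exact: sqrtr_ge0.
Qed.
Lemma linf_boundM x y : exists c : R, 0 <= c /\
  forall i, opnorm_le (x i *m y i) c.
Proof.
have [c [c0 hc]] := linf_bounded x; have [b [b0 hb]] := linf_bounded y.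
exists (c * b); split=> [|i]; [exact: mulr_ge0 | exact: opnorm_leM].
Qed.
Lemma linf_boundA x : exists c : R, 0 <= c /\
  forall i, opnorm_le (adjmx (x i)) c.
Proof.
have [c [c0 hc]] := linf_bounded x.
by exists c; split=> // i; exact: opnorm_le_adj.
Qed.

Definition linf_zero := Linf linf_bound0.
Definition linf_one := Linf linf_bound1.
Definition linf_scale a x := Linf (linf_boundZ a x).
Definition linf_opp x := Linf (linf_boundN x).
Definition linf_add x y := Linf (linf_boundD x y).
Definition linf_mul x y := Linf (linf_boundM x y).
Definition adj x := Linf (linf_boundA x).

Fact linf_addA : associative linf_add.
Proof. by move=> x y z; apply: linfP => i /=; rewrite addrA. Qed.
Fact linf_addC : commutative linf_add.
Proof. by move=> x y; apply: linfP => i /=; rewrite addrC. Qed.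
Fact linf_add0 : left_id linf_zero linf_add.
Proof. by move=> x; apply: linfP => i /=; rewrite add0r. Qed.
Fact linf_addN : left_inverse linf_zero linf_opp linf_add.
Proof. by move=> x; apply: linfP => i /=; rewrite addNr. Qed.
HB.instance Definition _ :=
  GRing.isZmodule.Build M linf_addA linf_addC linf_add0 linf_addN.

Fact linf_mulA : associative linf_mul.
Proof. by move=> x y z; apply: linfP => i /=; rewrite mulmxA. Qed.
Fact linf_mul1l : left_id linf_one linf_mul.
Proof. by move=> x; apply: linfP => i /=; rewrite mul1mx. Qed.
Fact linf_mul1r : right_id linf_one linf_mul.
Proof. by move=> x; apply: linfP => i /=; rewrite mulmx1. Qed.
Fact linf_mulDl : left_distributive linf_mul +%R.
Proof. by move=> x y z; apply: linfP => i /=; rewrite mulmxDl. Qed.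
Fact linf_mulDr : right_distributive linf_mul +%R.
Proof. by move=> x y z; apply: linfP => i /=; rewrite mulmxDr. Qed.
HB.instance Definition _ := GRing.Zmodule_isPzRing.Build M
  linf_mulA linf_mul1l linf_mul1r linf_mulDl linf_mulDr.

Fact linf_scaleA a b x : linf_scale a (linf_scale b x) = linf_scale (a * b) x.
Proof. by apply: linfP => i /=; rewrite scalerA. Qed.
Fact linf_scale1 : left_id 1 linf_scale.
Proof. by move=> x; apply: linfP => i /=; rewrite scale1r. Qed.
Fact linf_scaleDr : right_distributive linf_scale +%R.
Proof. by move=> a x y; apply: linfP => i /=; rewrite scalerDr. Qed.
Fact linf_scaleDl x : {morph linf_scale^~ x : a b / a + b}.
Proof. by move=> a b; apply: linfP => i /=; rewrite scalerDl. Qed.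
HB.instance Definition _ := GRing.Zmodule_isLmodule.Build C M
  linf_scaleA linf_scale1 linf_scaleDr linf_scaleDl.

(* ||x|| <= c *)
Definition linf_le x (c : R) : Prop := 0 <= c /\ forall i, opnorm_le (x i) c.

Definition lpos x : Prop :=
  forall i (v : 'cV[C]_(d i)), 0 <= (adjmx v *m x i *m v) 0 0.

(* Positivity of the matrix [X p q]_(p, q) in the von Neumann algebra M_n(l^infty). *)
Definition mpos n (X : 'M[M]_n) : Prop :=
  forall i (v : 'I_n -> 'cV[C]_(d i)),
    0 <= \sum_p \sum_q (adjmx (v p) *m X p q i *m v q) 0 0.

(* Bounded linear functionals, i.e. the Banach space dual of l^infty. *)
Record dual := Dual {
  dual_fun :> {scalar M};
  dual_bounded : exists K : R, forall x c,
    linf_le x c -> `|dual_fun x| <= (K * c)%:C }.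

(* Unconditional sum of a family of complex numbers. *)
Definition has_sum (a : I -> C) (s : C) : Prop :=
  forall e : R, 0 < e -> exists F0 : {fset I}, forall F : {fset I},
    (F0 `<=` F)%fset -> `|\sum_(i <- F) a i - s| < e%:C.

(* Membership in the predual l^1: the functional is given by a family of
   densities [t i] in M_(d i) with summable trace norms. *)
Definition normal (f : M -> C) : Prop :=
  exists (t : forall i, 'M[C]_(d i)) (c : I -> R),
    [/\ forall i, trnorm_le (t i) (c i),
        (\esum_(i in setT) (c i)%:E < +oo)%E &
        forall x, has_sum (fun i => \tr (t i *m x i)) (f x)].

Definition state (m : dual) : Prop := (forall x, lpos x -> 0 <= m x) /\ m 1 = 1.

(* The normal semifinite faithful weight on the positive part of l^infty with
   positive definite densities [h i]; every such weight is of this form. *)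
Definition weight (h : forall i, 'M[C]_(d i)) x : \bar R :=
  (\esum_(i in setT) (complex.Re (\tr (h i *m x i)))%:E)%E.

Lemma linf_leM x y a b : linf_le x a -> linf_le y b -> linf_le (x * y) (a * b).
Proof.
move=> [a0 ha] [b0 hb]; split=> [|i]; first exact: mulr_ge0.
exact: opnorm_leM.
Qed.

Lemma linf_sumE (J : Type) (r : seq J) (P : pred J) (F : J -> M) i :
  (\sum_(k <- r | P k) F k) i = \sum_(k <- r | P k) F k i.
Proof. by elim/big_rec2: _ => // k y z _ <-. Qed.

Section DualActions.
Variables (f : dual) (y : M).

Definition lact_fun x := f (x * y).
Definition ract_fun x := f (y * x).
Fact lact_linear : scalar lact_fun.
Proof.
move=> a u v; rewrite /lact_fun mulrDl linearD.
have -> : (a *: u) * y = a *: (u * y).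
  by apply: linfP => i /=; rewrite scalemxAl.
by rewrite linearZ.
Qed.
Fact ract_linear : scalar ract_fun.
Proof.
move=> a u v; rewrite /ract_fun mulrDr linearD.
have -> : y * (a *: u) = a *: (y * u).
  by apply: linfP => i /=; rewrite scalemxAr.
by rewrite linearZ.
Qed.
HB.instance Definition _ :=
  GRing.isLinear.Build C M C *%R lact_fun lact_linear.
HB.instance Definition _ :=
  GRing.isLinear.Build C M C *%R ract_fun ract_linear.
Fact lact_bounded : exists K : R, forall x c,
  linf_le x c -> `|lact_fun x| <= (K * c)%:C.
Proof.
have [K hK] := dual_bounded f; have [b hb] := linf_bounded y.
exists (K * b) => x c hx; rewrite -mulrA [b * c]mulrC; apply: hK.
exact: linf_leM.
Qed.
Fact ract_bounded : exists K : R, forall x c,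
  linf_le x c -> `|ract_fun x| <= (K * c)%:C.
Proof.
have [K hK] := dual_bounded f; have [b hb] := linf_bounded y.
by exists (K * b) => x c hx; rewrite -mulrA; apply: hK; exact: linf_leM.
Qed.

End DualActions.

(* y f : x |-> f (x y) and f y : x |-> f (y x) *)
Definition lact (y : M) (f : dual) : dual := Dual (lact_bounded f y).
Definition ract (f : dual) (y : M) : dual := Dual (ract_bounded f y).

End Linf.

(* The von Neumann tensor product of two such algebras is the algebra with
   blocks M_(d i) (x) M_(e j) = M_(d i * e j); indices of tensor products of
   matrices are pairs, through [mxtens_index]. *)
Definition tdim (I J : choiceType) (d : I -> nat) (e : J -> nat) (p : I * J) :=
  (d p.1 * e p.2)%N.

Section Tensor.
Variables (R : realType) (I J : choiceType) (d : I -> nat) (e : J -> nat).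
Notation C := R[i].
Notation M := (linf R d).
Notation N := (linf R e).
Notation MN := (linf R (tdim d e)).

Lemma tens_bounded (x : M) (y : N) : exists c : R, 0 <= c /\
  forall p : I * J, opnorm_le (x p.1 *t y p.2 : 'M[C]_(tdim d e p)) c.
Proof.
have [c [c0 hc]] := linf_bounded x; have [b [b0 hb]] := linf_bounded y.
exists (c * b); split=> [|p]; [exact: mulr_ge0 | exact: opnorm_le_tens].
Qed.
Definition tens (x : M) (y : N) : MN := Linf (tens_bounded x y).

Lemma tens_bij m p : bijective (@mxtens_index m p).
Proof.
exists (@mxtens_unindex m p); [exact: mxtens_indexK | exact: mxtens_unindexK].
Qed.
Lemma tens_flip_bij m p :
  bijective (fun ba : 'I_p * 'I_m => @mxtens_index m p (ba.2, ba.1)).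
Proof.
exists (fun k => ((mxtens_unindex k).2, (mxtens_unindex k).1)).
  move=> [b a].
  exact: (congr1 (fun q => (q.2, q.1)) (@mxtens_indexK m p (a, b))).
by move=> k; rewrite -surjective_pairing; exact: mxtens_unindexK.
Qed.

Definition coef2_blk j (b b' : 'I_(e j)) (X : MN) i : 'M[C]_(d i) :=
  \matrix_(a, a') X (i, j) (mxtens_index (a, b)) (mxtens_index (a', b')).
Definition coef1_blk i (a a' : 'I_(d i)) (X : MN) j : 'M[C]_(e j) :=
  \matrix_(b, b') X (i, j) (mxtens_index (a, b)) (mxtens_index (a', b')).

Lemma coef2_bounded j (b b' : 'I_(e j)) X : exists c : R, 0 <= c /\
  forall i, opnorm_le (coef2_blk b b' X i) c.
Proof.
have [c [c0 hc]] := linf_bounded X; exists c; split=> // i.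
exact: (opnorm_le_entry (@tens_bij _ _) b b' (hc (i, j))).
Qed.
Lemma coef1_bounded i (a a' : 'I_(d i)) X : exists c : R, 0 <= c /\
  forall j, opnorm_le (coef1_blk a a' X j) c.
Proof.
have [c [c0 hc]] := linf_bounded X; exists c; split=> // j.
exact: (opnorm_le_entry (@tens_flip_bij _ _) a a' (hc (i, j))).
Qed.

(* (id (x) w) X for w the (b, b') matrix coefficient of the block M_(e j), and
   (w (x) id) X for w the (a, a') matrix coefficient of the block M_(d i). *)
Definition coef2 j (b b' : 'I_(e j)) X : M := Linf (coef2_bounded b b' X).
Definition coef1 i (a a' : 'I_(d i)) X : N := Linf (coef1_bounded a a' X).

Definition slice1_blk (f : dual R d) (X : MN) j : 'M[C]_(e j) :=
  \matrix_(b, b') f (coef2 b b' X).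
Definition slice2_blk (g : dual R e) (X : MN) i : 'M[C]_(d i) :=
  \matrix_(a, a') g (coef1 a a' X).

Lemma form_sum n (A : 'M[C]_n) (v u : 'cV[C]_n) :
  (adjmx v *m A *m u) 0 0 = \sum_b \sum_b' (v b 0)^* * u b' 0 * A b b'.
Proof.
rewrite mxE exchange_big /=; apply: eq_bigr => b' _.
rewrite mxE mulr_suml; apply: eq_bigr => b _.
by rewrite !mxE; ring.
Qed.

Lemma sqnormM_real m n (v : 'cV[C]_m) (u : 'cV[C]_n) :
  sqnorm v * sqnorm u = (complex.Re (sqnorm v) * complex.Re (sqnorm u))%:C.
Proof. by rewrite {1}(sqnorm_real v) {1}(sqnorm_real u) [RHS]rmorphM. Qed.

Lemma slice_bound n (K c : R) (v u : 'cV[C]_n) (s : C) : 0 <= c ->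
  `|s| <= (K * (c * Num.sqrt (complex.Re (sqnorm v) * complex.Re (sqnorm u))))%:C ->
  `|s| ^+ 2 <= ((K * c) ^+ 2)%:C * (sqnorm v * sqnorm u).
Proof.
move=> c0 h; set q := _ * complex.Re (sqnorm u) in h.
have q0 : 0 <= q by rewrite mulr_ge0 ?Re_sqnorm_ge0.
have -> : ((K * c) ^+ 2)%:C * (sqnorm v * sqnorm u)
        = ((K * (c * Num.sqrt q)) ^+ 2)%:C :> C.
  have -> : (K * (c * Num.sqrt q)) ^+ 2 = (K * c) ^+ 2 * q.
    by rewrite mulrA [LHS]exprMn (sqr_sqrtr q0).
  by rewrite [RHS]rmorphM; congr (_ * _); rewrite sqnormM_real.
rewrite [leRHS]rmorphXn lerXn2r ?nnegrE //; exact: le_trans (normr_ge0 _) h.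
Qed.

Lemma slice1_bounded f X : exists c : R, 0 <= c /\
  forall j, opnorm_le (slice1_blk f X j) c.
Proof.
have [c [c0 hc]] := linf_bounded X; have [K hK] := dual_bounded f.
exists `|K * c|; split=> // j; apply: opnorm_le_form => u v.
rewrite (@real_normK _ (K * c)) ?num_real //.
pose Y : M := \sum_b \sum_b' ((v b 0)^* * u b' 0) *: coef2 b b' X.
have -> : (adjmx v *m slice1_blk f X j *m u) 0 0 = f Y.
  rewrite form_sum linear_sum; apply: eq_bigr => b _.
  by rewrite linear_sum; apply: eq_bigr => b' _; rewrite linearZ mxE.
apply: (slice_bound c0); apply: hK; split=> [|i].
  by rewrite mulr_ge0 ?sqrtr_ge0.
move=> w; rewrite exprMn sqr_sqrtr ?mulr_ge0 ?Re_sqnorm_ge0 //.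
rewrite [X in X * _]rmorphM -[X in _ * X * _]sqnormM_real.
have := sqnorm_slice (@tens_bij _ _) v u w (hc (i, j)).
congr (sqnorm (_ *m w) <= _); apply/matrixP => a a'; rewrite mxE.
rewrite linf_sumE summxE; apply: eq_bigr => b _.
rewrite linf_sumE summxE; apply: eq_bigr => b' _.
by rewrite !mxE; ring.
Qed.

Lemma slice2_bounded g X : exists c : R, 0 <= c /\
  forall i, opnorm_le (slice2_blk g X i) c.
Proof.
have [c [c0 hc]] := linf_bounded X; have [K hK] := dual_bounded g.
exists `|K * c|; split=> // i; apply: opnorm_le_form => u v.
rewrite (@real_normK _ (K * c)) ?num_real //.
pose Y : N := \sum_a \sum_a' ((v a 0)^* * u a' 0) *: coef1 a a' X.
have -> : (adjmx v *m slice2_blk g X i *m u) 0 0 = g Y.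
  rewrite form_sum linear_sum; apply: eq_bigr => b _.
  by rewrite linear_sum; apply: eq_bigr => b' _; rewrite linearZ mxE.
apply: (slice_bound c0); apply: hK; split=> [|j].
  by rewrite mulr_ge0 ?sqrtr_ge0.
move=> w; rewrite exprMn sqr_sqrtr ?mulr_ge0 ?Re_sqnorm_ge0 //.
rewrite [X in X * _]rmorphM -[X in _ * X * _]sqnormM_real.
have := sqnorm_slice (@tens_flip_bij _ _) v u w (hc (i, j)).
congr (sqnorm (_ *m w) <= _); apply/matrixP => a a'; rewrite mxE.
rewrite linf_sumE summxE; apply: eq_bigr => b _.
rewrite linf_sumE summxE; apply: eq_bigr => b' _.
by rewrite !mxE; ring.
Qed.

(* (f (x) id) X and (id (x) g) X, computed entrywise. *)
Definition slice1 (f : dual R d) (X : MN) : N := Linf (slice1_bounded f X).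
Definition slice2 (g : dual R e) (X : MN) : M := Linf (slice2_bounded g X).
End Tensor.

Section Coassociativity.
Variables (R : realType) (I : choiceType) (d : I -> nat).
Notation C := R[i].
Notation M := (linf R d).
Notation MM := (linf R (tdim d d)).
Variable D : M -> MM.

(* The (i, j, k) blocks of (D (x) id) X and (id (x) D) X, as matrices indexed
   by triples encoded as ((a, b), c). *)
Definition D_id (X : MM) (p : I * I * I) :
    'M[C]_(d p.1.1 * d p.1.2 * d p.2) :=
  \matrix_(r, s)
    let: (ab, c) := mxtens_unindex r in let: (ab', c') := mxtens_unindex s in
    D (coef2 c c' X) (p.1.1, p.1.2) ab ab'.

Definition id_D (X : MM) (p : I * I * I) :
    'M[C]_(d p.1.1 * d p.1.2 * d p.2) :=
  \matrix_(r, s)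
    let: (ab, c) := mxtens_unindex r in let: (ab', c') := mxtens_unindex s in
    let: (a, b) := mxtens_unindex ab in let: (a', b') := mxtens_unindex ab' in
    D (coef1 a a' X) (p.1.2, p.2) (mxtens_index (b, c)) (mxtens_index (b', c')).

Definition coassociative : Prop := forall x p, D_id (D x) p = id_D (D x) p.
End Coassociativity.

(* A discrete quantum group is a locally compact quantum group (in the von
   Neumann algebraic sense of Kustermans and Vaes) whose von Neumann algebra is
   a direct sum of full matrix algebras, equivalently whose convolution algebra
   l^1 has a unit; the unit is the counit, a normal *-character. *)
Record discrete_quantum_group (R : realType) := DiscreteQuantumGroup {
  irr : choiceType;
  irr_dim : irr -> nat;
  dim_gt0 : forall i, (0 < irr_dim i)%N;
  comul : {linear linf R irr_dim -> linf R (tdim irr_dim irr_dim)};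
  comul1 : comul 1 = 1;
  comulM : forall x y, comul (x * y) = comul x * comul y;
  comul_adj : forall x, comul (adj x) = adj (comul x);
  comul_normal : forall g : linf R (tdim irr_dim irr_dim) -> R[i],
    normal g -> normal (g \o comul);
  comul_coassoc : coassociative comul;
  counit : dual R irr_dim;
  counit_normal : normal counit;
  counit1 : counit 1 = 1;
  counitM : forall x y, counit (x * y) = counit x * counit y;
  counit_adj : forall x, counit (adj x) = (counit x)^*;
  counitl : forall x, slice1 counit (comul x) = x;
  counitr : forall x, slice2 counit (comul x) = x;
  haar_left : exists h : forall i, 'M[R[i]]_(irr_dim i),
    (forall i, posdefmx (h i)) /\
    forall (w : dual R irr_dim) x, normal w -> (forall y, lpos y -> 0 <= w y) ->
      lpos x -> (weight h x < +oo)%E ->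
      weight h (slice1 w (comul x)) = ((complex.Re (w 1))%:E * weight h x)%E;
  haar_right : exists h : forall i, 'M[R[i]]_(irr_dim i),
    (forall i, posdefmx (h i)) /\
    forall (w : dual R irr_dim) x, normal w -> (forall y, lpos y -> 0 <= w y) ->
      lpos x -> (weight h x < +oo)%E ->
      weight h (slice2 w (comul x)) = ((complex.Re (w 1))%:E * weight h x)%E
}.

Section QuantumGroup.
Variables (R : realType) (G : discrete_quantum_group R).
Notation M := (linf R (@irr_dim R G)).
Notation M' := (dual R (@irr_dim R G)).

(* x * f *)
Definition modact (x : M) (f : M') : M := slice1 f (comul G x).

(* f * m *)
Definition conv (f : M') (m : M -> R[i]) (x : M) : R[i] := m (modact x f).

Definition group_like_projection (P : M) : Prop :=
  [/\ adj P = P, P * P = P & tens 1 P * comul G P = tens P P].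

Definition Ntilde (P : M) : set M :=
  [set x | tens 1 P * comul G x = tens x P].

Definition completely_positive (E : {linear M -> M}) : Prop :=
  forall n (X : 'M[M]_n), mpos X -> mpos (map_mx E X).

(* Used for right coideals [N]; since [N] is then a von Neumann subalgebra, a
   completely positive map into [N] is one into l^infty with values in [N]. *)
Definition relatively_amenable (N : set M) : Prop :=
  exists E : {linear M -> M},
    [/\ E 1 = 1, completely_positive E,
        forall (x : M) (f : M'), normal f -> E (modact x f) = modact (E x) f &
        forall x, N (E x)].

Definition left_invariant (P : M) (m : M') : Prop :=
  (forall f : M', normal f -> forall x, conv (ract f P) m x = f P * m x) \/
  (forall f : M', normal f -> forall x, conv (lact P f) m x = f P * m x).
End QuantumGroup.

(* Main.v *)
Require Import Defs.
From mathcomp Require Import all_boot all_order all_algebra complex.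
From mathcomp Require Import boolp classical_sets reals.
From HB Require Import structures.
From mathcomp Require Import finmap mxtens ring lra cardinality fsbigop ereal esum.

(** Why the theorem holds. Write [M] for the algebra, [Delta] for the
    comultiplication and [eps] for the counit.

    If [E : M -> Ntilde P] is a unital completely positive module map, then
    [m = eps o E] is an invariant state. Indeed applying [eps] to the first leg
    of [(1 (x) P) Delta(y) = y (x) P] gives [P y = eps(y) P] for [y] in
    [Ntilde P] ([Ntilde_mul]), and therefore
    [m (x * (f P)) = eps (E x * (f P)) = f (P E(x)) = m(x) f(P)].

    Conversely, an invariant state [m] gives the map
    [average m = (id (x) m) Delta], characterised by
    [f (average m x) = m (x * f)] for normal [f] ([average_conv]). It is unital
    and completely positive, it is a module map by coassociativity
    ([average_modact]), and invariance of [m] says precisely that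
    [P (average m x) = m(x) P] ([left_invariant_mul]). The module property turns
    this equation into membership in [Ntilde P] ([average_Ntilde]).

    The work lies in the analysis, because [m] need not be normal. Two tools
    carry it. The first is that finite combinations of matrix entries are norm
    dense in the predual ([normal_eq0]): it proves the Fubini rule
    [m ((f (x) id) X) = f ((id (x) m) X)] for normal [f] ([slice_Fubini]) and
    reduces the module property to matrix entries. The second is that a normal
    *-representation on matrices is completely positive ([normal_rep_cp]); it
    applies to the counit and to the blocks of [Delta], and shows that [Delta] is
    completely positive and contractive. *)

Set Implicit Arguments.
Unset Strict Implicit.
Unset Printing Implicit Defensive.
Import Order.TTheory GRing.Theory Num.Theory.

Local Open Scope ring_scope.
Local Notation "x %:C" := (real_complex _ x) : ring_scope.
(* The name also denotes a lemma on polynomials. *)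
Local Notation coef1 := Defs.coef1.

(** * Unconditional sums *)

Section UnconditionalSums.
Variables (R : realType) (I : choiceType).
Notation C := R[i].
Implicit Types (a b : I -> C) (s t z : C).

Lemma normCE z : `|z| = (complex.Re `|z|)%:C.
Proof. by rewrite RRe_real // normr_real. Qed.

Lemma Re_norm_ge0 z : 0 <= complex.Re `|z|.
Proof. by rewrite -realC_ge0 -normCE. Qed.

Lemma small_eq0 z (K : R) : 0 <= K ->
  (forall e : R, 0 < e -> `|z| <= (K * e)%:C) -> z = 0.
Proof.
move=> K0 h; apply/eqP; rewrite -normr_eq0 normCE.
suff /eqP -> : complex.Re `|z| == 0 by [].
rewrite eq_le Re_norm_ge0 andbT leNgt; apply/negP => z0.
have K1 : 0 < 2 * (K + 1) by lra.
have := h _ (divr_gt0 z0 K1); rewrite normCE lecR; apply/negP; rewrite -ltNge.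
rewrite mulrA ltr_pdivrMr // mulrC ltr_pM2l //; lra.
Qed.

Lemma sum_fsetD (V : zmodType) (g : I -> V) (F F' : {fset I}) :
  (F `<=` F')%fset ->
  \sum_(i <- F') g i = \sum_(i <- F) g i + \sum_(i <- (F' `\` F)%fset) g i.
Proof.
move=> /fsubsetP FF'; rewrite (big_fsetID _ (mem F)) /=; congr (_ + _).
  by apply: eq_fbigl => i; rewrite !inE /= andbC; case: (boolP (i \in F)) => //= /FF'.
by apply: eq_fbigl => i; rewrite !inE /= andbC.
Qed.

Lemma has_sum0 : has_sum (fun _ : I => 0) (0 : C).
Proof.
by move=> e e0; exists fset0 => F _; rewrite big1 // subrr normr0 ltcR.
Qed.

Lemma has_sum_axpy z a b s t : has_sum a s -> has_sum b t ->
  has_sum (fun i => z * a i + b i) (z * s + t).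
Proof.
move=> ha hb e e0; set n := complex.Re `|z|.
have n0 : 0 <= n := Re_norm_ge0 z.
have n1 : 0 < 2 * (n + 1) by lra.
have [F1 h1] := ha _ (divr_gt0 e0 n1).
have [F2 h2] := hb _ (divr_gt0 e0 (ltr0n _ 2)).
exists (F1 `|` F2)%fset => F; rewrite fsubUset => /andP[/h1 k1 /h2 k2].
rewrite big_split -mulr_sumr /= opprD addrACA -mulrBr.
apply: le_lt_trans (ler_normD _ _) _; rewrite normrM.
have k : `|z| * `|\sum_(i <- F) a i - s| <= (e / 2)%:C.
  apply: le_trans (ler_wpM2l (normr_ge0 _) (ltW k1)) _.
  rewrite normCE -/n -rmorphM lecR mulrCA ler_pM2l // ler_pdivrMr //.
  by rewrite mulrA mulVf ?mul1r; lra.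
have -> : e%:C = (e / 2)%:C + (e / 2)%:C :> C by rewrite -rmorphD -splitr.
exact: ler_ltD.
Qed.

Lemma has_sum_lin (J : Type) (r : seq J) (z : J -> C) (a : J -> I -> C)
    (s : J -> C) :
  (forall j, has_sum (a j) (s j)) ->
  has_sum (fun i => \sum_(j <- r) z j * a j i) (\sum_(j <- r) z j * s j).
Proof.
move=> h; elim: r => [|j r IH].
  by rewrite big_nil; under eq_fun do rewrite big_nil; exact: has_sum0.
rewrite big_cons; under eq_fun do rewrite big_cons.
exact: has_sum_axpy.
Qed.

Lemma has_sum_sum (J : Type) (r : seq J) (a : J -> I -> C) (s : J -> C) :
  (forall j, has_sum (a j) (s j)) ->
  has_sum (fun i => \sum_(j <- r) a j i) (\sum_(j <- r) s j).
Proof.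
move=> /(has_sum_lin r (fun=> 1)).
under eq_bigr do rewrite mul1r.
by under eq_fun do under eq_bigr do rewrite mul1r.
Qed.

Lemma has_sum_uniq a s t : has_sum a s -> has_sum a t -> s = t.
Proof.
move=> hs ht; apply/eqP; rewrite -subr_eq0; apply/eqP.
apply: (@small_eq0 _ 2) => // e e0.
have [F1 /(_ _ (fsubsetUl _ F1)) h1] := hs e e0.
have [F2 h2] := ht e e0.
have [F3 h3] := hs e e0.
have k2 := h2 (F3 `|` F2)%fset (fsubsetUr _ _).
have k3 := h3 (F3 `|` F2)%fset (fsubsetUl _ _).
have -> : (2 * e)%:C = e%:C + e%:C :> C by rewrite -rmorphD mulr2n mulrDl mul1r.
apply: le_trans (ler_distD (\sum_(i <- (F3 `|` F2)%fset) a i) _ _) _.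
by apply: lerD; rewrite ?(distrC s); exact: ltW.
Qed.

Lemma has_sum1 a i0 : (forall i, i != i0 -> a i = 0) -> has_sum a (a i0).
Proof.
move=> h e e0; exists [fset i0]%fset => F /fsubsetP/(_ i0 (fset11 _)) iF.
rewrite (big_fsetD1 i0) //= big1_fset ?addr0 ?subrr ?normr0 ?ltcR // => i.
by rewrite !inE => /andP[/h].
Qed.

(** Arguing with [s - |s|] settles at once that [s] is real and that it is
    nonnegative, since every partial sum [t] satisfies [t = |t|]. *)
Lemma has_sum_ge0 a s : (forall i, 0 <= a i) -> has_sum a s -> 0 <= s.
Proof.
move=> a0 h; suff /eqP : s - `|s| = 0 by rewrite subr_eq0 => /eqP ->.
apply: (@small_eq0 _ 2) => // e /h[F /(_ _ (fsubset_refl _))/ltW k].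
set t := \sum_(i <- F) a i in k.
have t0 : 0 <= t by exact: sumr_ge0.
have -> : (2 * e)%:C = e%:C + e%:C :> C by rewrite -rmorphD mulr2n mulrDl mul1r.
apply: le_trans (ler_distD t _ _) _; apply: lerD; first by rewrite distrC.
by rewrite -[X in X - _](ger0_norm t0); apply: le_trans (ler_dist_dist _ _) k.
Qed.

End UnconditionalSums.

Section FiniteEsum.
Variables (R : realType) (I : choiceType) (c : I -> R).
Hypothesis c0 : forall i, 0 <= c i.

Lemma fset_sum_le_esum (F : {fset I}) :
  ((\sum_(i <- F) c i)%:E <= \esum_(i in setT) (c i)%:E)%E.
Proof.
apply: esum_ge; exists [set` F]%classic; first by split=> //; exact: finite_fset.
by rewrite fsbig_finite ?set_fsetK ?sumEFin //; exact: finite_fset.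
Qed.

Lemma esum_lty (K : R) : (forall F : {fset I}, \sum_(i <- F) c i <= K) ->
  (\esum_(i in setT) (c i)%:E < +oo)%E.
Proof.
move=> h; apply: (@le_lt_trans _ _ K%:E); last exact: ltry.
apply: ge_ereal_sup => _ [X [fX _] <-].
by rewrite fsbig_finite // sumEFin lee_fin.
Qed.

(** Past a suitable finite set, any further finite sum adds at most [e]: this is
    the form in which summability of the trace norms is used. *)
Lemma esum_tail (e : R) : (\esum_(i in setT) (c i)%:E < +oo)%E -> 0 < e ->
  exists F : {fset I}, forall F' : {fset I},
    (F `<=` F')%fset -> \sum_(i <- F') c i <= \sum_(i <- F) c i + e.
Proof.
move=> fin e0.
have fn : \esum_(i in setT) (c i)%:E \is a fin_num.
  by rewrite ge0_fin_numE //; apply: esum_ge0 => i _; rewrite lee_fin.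
have [x [X [fX _] <-] hx] := ub_ereal_sup_adherent e0 fn.
exists (fset_set X) => F' _.
move: hx; rewrite -/(esum _ _) fsbig_finite // sumEFin lteBlDr // => hx.
by have := le_lt_trans (fset_sum_le_esum F') hx; rewrite -EFinD lte_fin => /ltW.
Qed.

End FiniteEsum.

(** * Matrix units and normal functionals *)

Section MatrixNorms.
Variables (R : realType).
Notation C := R[i].

Lemma opnorm_le0 n c : opnorm_le (0 : 'M[C]_n) c.
Proof.
move=> u; rewrite mul0mx /sqnorm big1 => [|k _].
  by rewrite mulr_ge0 ?realC_ge0 ?sqr_ge0 // sqnorm_ge0.
by rewrite mxE normr0 expr0n.
Qed.

Lemma normsqr_le_sqnorm n (u : 'cV[C]_n) k : `|u k 0| ^+ 2 <= sqnorm u.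
Proof.
rewrite /sqnorm (bigD1 k) //= lerDl; apply: sumr_ge0 => j _.
by rewrite exprn_ge0.
Qed.

Lemma sqnorm_delta n (k : 'I_n) : sqnorm (delta_mx k 0 : 'cV[C]_n) = 1.
Proof.
rewrite /sqnorm (bigD1 k) //= big1 ?addr0 => [|j /negPf jk].
  by rewrite mxE !eqxx normr1 expr1n.
by rewrite mxE jk normr0 expr0n.
Qed.

Lemma opnorm_le_delta n (a b : 'I_n) : opnorm_le (delta_mx a b : 'M[C]_n) 1.
Proof.
move=> u; rewrite expr1n rmorph1 mul1r.
have -> : delta_mx a b *m u = u b 0 *: delta_mx a 0.
  apply/colP => k; rewrite !mxE (bigD1 b) //= big1 ?addr0 => [|j /negPf jb].
    by rewrite !mxE eqxx !andbT mulrC.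
  by rewrite !mxE jb andbF mul0r.
by rewrite sqnormZ sqnorm_delta mulr1 normsqr_le_sqnorm.
Qed.

(** Apply [A] to the basis vector [b] and read off its coordinate [a]. *)
Lemma opnorm_le_mxentry n (A : 'M[C]_n) (c : R) a b :
  0 <= c -> opnorm_le A c -> `|A a b| <= c%:C.
Proof.
move=> c0 /(_ (delta_mx b 0)); rewrite sqnorm_delta mulr1 -colE => h.
rewrite -(@ler_pXn2r _ 2) ?nnegrE ?normr_ge0 ?realC_ge0 //.
have -> : c%:C ^+ 2 = (c ^+ 2)%:C :> C by rewrite rmorphXn.
by have := le_trans (normsqr_le_sqnorm _ a) h; rewrite mxE.
Qed.

Lemma trnorm_le_ge0 n (t : 'M[C]_n) (k : R) : trnorm_le t k -> 0 <= k.
Proof.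
move=> /(_ 0 (@opnorm_le0 n 1)).
by rewrite mulmx0 mxtrace0 normr0 realC_ge0.
Qed.

(** The trace norm is defined through contractions; this is the homogeneous
    version. The case [c = 0], where one cannot divide by [c], forces [A = 0]. *)
Lemma trnorm_leM n (t A : 'M[C]_n) (k c : R) : 0 <= c ->
  trnorm_le t k -> opnorm_le A c -> `|\tr (t *m A)| <= (k * c)%:C.
Proof.
rewrite [0 <= c]le_eqVlt => /predU1P[<-|c0] h hA.
  suff -> : A = 0 by rewrite mulmx0 mxtrace0 normr0 mulr0 realC_ge0.
  apply/matrixP => a b; have := opnorm_le_mxentry a b (lexx 0) hA.
  by rewrite normr_le0 mxE => /eqP.
have cC : c%:C != 0 :> C by rewrite gt_eqF // ltcR.
have := h (c^-1%:C *: A); rewrite -scalemxAr mxtraceZ normrM.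
have -> : `|c^-1%:C| = (c%:C)^-1 :> C.
  by rewrite fmorphV ger0_norm // invr_ge0 realC_ge0 ltW.
rewrite mulrC ler_pdivrMr ?ltcR // rmorphM; apply=> u.
rewrite -scalemxAl sqnormZ expr1n rmorph1 mul1r fmorphV normfV exprVn.
rewrite mulrC ler_pdivrMr ?exprn_gt0 ?normr_gt0 //.
rewrite ger0_norm ?realC_ge0 ?(ltW c0) // mulrC -rmorphXn; exact: hA.
Qed.

End MatrixNorms.

Section Normal.
Variables (R : realType) (I : choiceType) (d : I -> nat).
Notation C := R[i].
Notation M := (linf R d).
Notation M' := (dual R d).

(** The matrix unit [e_ab] of the block [i], seen in the block [k]. Comparing
    indices as natural numbers avoids a cast between [d i] and [d k]. *)
Definition munit_blk i (a b : 'I_(d i)) k : 'M[C]_(d k) :=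
  \matrix_(r, s) [&& k == i, r == a :> nat & s == b :> nat]%:R.

Lemma munit_blkE i (a b : 'I_(d i)) : munit_blk a b i = delta_mx a b.
Proof. by apply/matrixP => r s; rewrite !mxE eqxx. Qed.

Lemma munit_blk0 i (a b : 'I_(d i)) k : k != i -> munit_blk a b k = 0.
Proof. by move=> /negPf ki; apply/matrixP => r s; rewrite !mxE ki. Qed.

Lemma munit_bounded i (a b : 'I_(d i)) : exists c : R, 0 <= c /\
  forall k, opnorm_le (munit_blk a b k) c.
Proof.
exists 1; split=> // k; have [->|ki] := eqVneq k i.
  by rewrite munit_blkE; exact: opnorm_le_delta.
by rewrite munit_blk0 //; exact: opnorm_le0.
Qed.

Definition munit i (a b : 'I_(d i)) : M := Linf (munit_bounded a b).

(** Every matrix unit is of the form [y^* z], where [y] and [z] are matrix units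
    with a common row index [o]. This is what makes positivity of
    representations computable, see [normal_rep_cp]. *)
Lemma munitE i (o a b : 'I_(d i)) : adj (munit o a) * munit o b = munit a b.
Proof.
apply: linfP => k /=; have [->|ki] := eqVneq k i; last first.
  by rewrite !munit_blk0 // mulmx0.
rewrite !munit_blkE; apply/matrixP => r s.
rewrite !mxE (bigD1 o) //= big1 ?addr0 => [|j /negPf jo].
  by rewrite !mxE !eqxx /= rmorph_nat -natrM mulnb.
by rewrite !mxE jo mulr0.
Qed.

Section Entry.
Variables (i : I) (a b : 'I_(d i)).
Definition entry_fun (x : M) : C := x i a b.
Fact entry_linear : scalar entry_fun.
Proof. by move=> z x y; rewrite /entry_fun /= !mxE. Qed.
HB.instance Definition _ := GRing.isLinear.Build C M C *%R entry_fun entry_linear.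
Fact entry_bounded : exists K : R, forall x c,
  linf_le x c -> `|entry_fun x| <= (K * c)%:C.
Proof.
by exists 1 => x c [c0 hx]; rewrite mul1r; exact: opnorm_le_mxentry (hx i).
Qed.
Definition entry : M' := Dual entry_bounded.
Lemma entryE x : entry x = x i a b. Proof. by []. Qed.

Lemma trace_munit (A : 'M[C]_(d i)) : \tr (munit_blk b a i *m A) = A a b.
Proof.
rewrite munit_blkE mxtrace_mulC /mxtrace (bigD1 a) //= big1 ?addr0.
  rewrite mxE (bigD1 b) //= big1 ?addr0 => [|j /negPf jb]; last by rewrite mxE jb mulr0.
  by rewrite mxE !eqxx mulr1.
move=> j /negPf ja; rewrite mxE big1 // => k _.
by rewrite mxE ja andbF mulr0.
Qed.

Lemma entry_normal : normal entry.
Proof.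
exists (munit_blk b a), (fun k => (k == i)%:R); split.
- move=> k A hA; have [ki|ki] := eqVneq k i; last first.
    by rewrite munit_blk0 // mul0mx mxtrace0 normr0.
  move: A hA; rewrite ki => A hA; rewrite trace_munit.
  exact: opnorm_le_mxentry.
- apply: (@esum_lty _ _ _ 1) => F; have [iF|iF] := boolP (i \in F).
    rewrite (big_fsetD1 i) //= eqxx big1_fset ?addr0 // => k.
    by rewrite !inE => /andP[/negPf ->].
  rewrite big1_fset // => k kF _; case: eqVneq => // ki.
  by rewrite ki (negPf iF) in kF.
- move=> x; have := @has_sum1 _ _ (fun k => \tr (munit_blk b a k *m x k)) i.
  rewrite trace_munit; apply=> k ki.
  by rewrite munit_blk0 // mul0mx mxtrace0.
Qed.
End Entry.

(** The value of a linear [f] on the part of [x] that lies in the block [i]. *)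
Definition blockpart (f : M -> C) (x : M) i :=
  \sum_a \sum_b x i a b * f (munit a b).

(** A normal functional determines its densities, as
    [f (e_ab) = tr (t_i e_ab) = (t_i)_ba]; so the sum that represents [f] can be
    written without mentioning them. *)
Lemma normal_density (f : M -> C) (t : forall i, 'M[C]_(d i)) :
  (forall x : M, has_sum (fun i => \tr (t i *m x i)) (f x)) ->
  forall (x : M) i, \tr (t i *m x i) = blockpart f x i.
Proof.
move=> h x i; have fE a b : f (munit a b) = t i b a.
  apply: (has_sum_uniq (h _)).
  have := @has_sum1 _ _ (fun k => \tr (t k *m munit a b k)) i.
  rewrite /= mxtrace_mulC trace_munit; apply => k ki.
  by rewrite munit_blk0 // mulmx0 mxtrace0.
rewrite mxtrace_mulC; apply: eq_bigr => a _; rewrite mxE.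
by apply: eq_bigr => b _; rewrite fE.
Qed.

Lemma normal_has_sum (f : M -> C) x : normal f -> has_sum (blockpart f x) (f x).
Proof.
case=> t [c [_ _ h]].
by rewrite (_ : blockpart f x = fun i => \tr (t i *m x i)) //;
  apply/funext => i; rewrite (normal_density h).
Qed.

(** A normal functional is the norm limit of its restrictions to finitely many
    blocks: the restriction to the other blocks has norm at most the tail of the
    sum of the trace norms. *)
Lemma normal_approx (f : M -> C) (e : R) : normal f -> 0 < e ->
  exists F : {fset I}, forall x k, linf_le x k ->
    `|f x - \sum_(i <- F) blockpart f x i| <= (e * k)%:C.
Proof.
move=> nf e0; have [t [c [tc fin h]]] := nf.
have c0 i : 0 <= c i := trnorm_le_ge0 (tc i).
have [F hF] := esum_tail c0 fin e0; exists F => x k [k0 hx].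
rewrite -subr_le0.
have key (e' : R) : 0 < e' ->
    `|f x - \sum_(i <- F) blockpart f x i| <= (e * k)%:C + e'%:C.
  move=> e'0; have [F0 h0] := normal_has_sum x nf e'0.
  set F' := (F `|` F0)%fset.
  have FF' : (F `<=` F')%fset := fsubsetUl _ _.
  have := ltW (h0 F' (fsubsetUr _ _)); rewrite distrC => k1.
  apply: le_trans (ler_distD (\sum_(i <- F') blockpart f x i) _ _) _.
  rewrite addrC; apply: lerD => //.
  rewrite (sum_fsetD _ FF') addrAC subrr add0r; apply: le_trans (ler_norm_sum _ _ _) _.
  apply: (@le_trans _ _ (\sum_(i <- (F' `\` F)%fset) (c i * k)%:C)).
    apply: ler_sum => i _; rewrite -(normal_density h).
    exact: trnorm_leM.
  rewrite -rmorph_sum lecR -mulr_suml ler_wpM2r //.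
  by have := hF F' FF'; rewrite (sum_fsetD _ FF') lerD2l.
rewrite subr_le0 normCE lecR; apply/ler_addgt0Pr => e' e'0.
by have := key _ e'0; rewrite normCE -rmorphD lecR.
Qed.

Definition dual_le (f : M -> C) (K : R) :=
  0 <= K /\ forall x c, linf_le x c -> `|f x| <= (K * c)%:C.

Lemma dual_leP (f : M') : exists K, dual_le f K.
Proof.
have [K hK] := dual_bounded f; exists `|K|; split=> // x c hx.
apply: le_trans (hK x c hx) _; rewrite lecR ler_wpM2r ?ler_norm //.
by case: hx.
Qed.

Section Axpy.
Variables (z : C) (f g : M').
Definition axpy_fun x := z * f x + g x.
Fact axpy_linear : scalar axpy_fun.
Proof. by move=> a x y; rewrite /axpy_fun !linearP; ring. Qed.
HB.instance Definition _ := GRing.isLinear.Build C M C *%R axpy_fun axpy_linear.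
Fact axpy_bounded : exists K : R, forall x c,
  linf_le x c -> `|axpy_fun x| <= (K * c)%:C.
Proof.
have [K [K0 hK]] := dual_leP f; have [L [L0 hL]] := dual_leP g.
exists (complex.Re `|z| * K + L) => x c hx.
rewrite mulrDl rmorphD; apply: le_trans (ler_normD _ _) _; apply: lerD; last exact: hL.
rewrite normrM -mulrA {1}normCE rmorphM /=; apply: ler_wpM2l; last exact: hK.
by rewrite -normCE.
Qed.
Definition axpy : M' := Dual axpy_bounded.
End Axpy.

(** Density principle: finite combinations of entry functionals are norm dense
    in the predual, so a bounded linear [T] that kills the entry functionals
    kills every normal functional. Identities in a normal functional are thus
    reduced to matrix entries, even when they also involve a functional that is
    not normal. *)
Lemma normal_eq0 (T : M' -> C) (K : R) : 0 <= K ->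
  (forall z (f g : M'), T (axpy z f g) = z * T f + T g) ->
  (forall (f : M') k, dual_le f k -> `|T f| <= (K * k)%:C) ->
  (forall i (a b : 'I_(d i)), T (entry a b) = 0) ->
  forall f : M', normal f -> T f = 0.
Proof.
move=> K0 Tlin Tle Tentry f nf.
(* The functionals in the kernel of [T], up to extensional equality. *)
pose S (phi : M -> C) := exists2 g : M', T g = 0 & g =1 phi.
have S0 : S (fun=> 0).
  by exists (axpy (-1) f f) => [|x]; rewrite ?Tlin ?mulN1r ?addNr //= /axpy_fun mulN1r addNr.
have SD phi psi z : S phi -> S psi -> S (fun x => z * phi x + psi x).
  move=> [g Tg gE] [h Th hE]; exists (axpy z g h) => [|x].
    by rewrite Tlin Tg Th mulr0 addr0.
  by rewrite /= /axpy_fun gE hE.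
have Ssum (J : Type) (r : seq J) (phi : J -> M -> C) :
    (forall j, S (phi j)) -> S (fun x => \sum_(j <- r) phi j x).
  move=> h; elim: r => [|j r IH]; first by under eq_fun do rewrite big_nil.
  by under eq_fun do rewrite big_cons -[X in X + _]mul1r; exact: SD.
apply: (small_eq0 K0) => e /(normal_approx nf)[F hF].
have [g Tg gE] : S (fun x => \sum_(i <- F) blockpart f x i).
  apply: (Ssum _) => i; apply: (Ssum _) => a; apply: (Ssum _) => b.
  have := SD (entry a b) _ (f (munit a b)) _ S0.
  under eq_fun do rewrite addr0 mulrC; apply.
  by exists (entry a b).
have -> : T f = T (axpy (-1) g f) by rewrite Tlin Tg mulr0 add0r.
apply: Tle; split=> [|x k hx].
  have := hF 0 1; have l0 : linf_le (0 : M) 1 by split=> // i; exact: opnorm_le0.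
  by move=> /(_ l0); rewrite mulr1; move/(le_trans (normr_ge0 _)); rewrite realC_ge0.
by rewrite /= /axpy_fun gE mulN1r addrC hF.
Qed.

(** Densities whose trace norms are dominated by a multiple of a summable
    family define a normal functional. *)
Lemma normal_rescale (g : M -> C) (t : forall i, 'M[C]_(d i)) (c : I -> R)
    (b : R) : 0 <= b -> (forall i, 0 <= c i) ->
  (\esum_(i in setT) (c i)%:E < +oo)%E ->
  (forall i, trnorm_le (t i) (c i * b)) ->
  (forall x : M, has_sum (fun i => \tr (t i *m x i)) (g x)) -> normal g.
Proof.
move=> b0 c0 fin tc h; exists t, (fun i => c i * b); split=> //.
have [F hF] := esum_tail c0 fin ltr01.
apply: (@esum_lty _ _ _ ((\sum_(i <- F) c i + 1) * b)) => F'.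
rewrite -mulr_suml ler_wpM2r //.
apply: le_trans (hF (F `|` F')%fset (fsubsetUl _ _)).
by rewrite (sum_fsetD _ (fsubsetUr F F')) lerDl sumr_ge0.
Qed.

Lemma normal_lact (y : M) (f : M') : normal f -> normal (lact y f).
Proof.
case=> t [c [tc fin h]]; have [b [b0 hb]] := linf_bounded y.
apply: (@normal_rescale _ (fun i => y i *m t i) c b) => //.
- by move=> i; exact: trnorm_le_ge0.
- move=> i A hA; rewrite -mulmxA mxtrace_mulC -mulmxA.
  by apply: trnorm_leM => //; rewrite -[b]mul1r; exact: opnorm_leM.
- by move=> x; under eq_fun do rewrite -mulmxA mxtrace_mulC -mulmxA; exact: h (x * y).
Qed.

Lemma normal_ract (y : M) (f : M') : normal f -> normal (ract f y).
Proof.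
case=> t [c [tc fin h]]; have [b [b0 hb]] := linf_bounded y.
apply: (@normal_rescale _ (fun i => t i *m y i) c b) => //.
- by move=> i; exact: trnorm_le_ge0.
- move=> i A hA; rewrite -mulmxA.
  by apply: trnorm_leM => //; rewrite -[b]mulr1; exact: opnorm_leM.
- by move=> x; under eq_fun do rewrite -mulmxA; exact: h (y * x).
Qed.

End Normal.

(** * Normal representations are completely positive *)

Section CompletePositivity.
Variables (R : realType) (I : choiceType) (d : I -> nat).
Notation C := R[i].
Notation M := (linf R d).

(** By normality the form is an unconditional sum over the blocks [i] of [M], so
    it suffices to treat one block. There [X p q i] is the combination of the
    matrix units [e_ab] with coefficients [X p q i a b], and
    [rho (e_ab) = rho (e_oa)^* rho (e_ob)] for any row index [o]. Hence the form
    at the vectors [w p] is the sum, over the coordinates [k], of the form of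
    [X _ _ i] itself at the vectors with coordinates
    [a |-> (rho (e_oa) (w p)) k], and each term is nonnegative. *)
Lemma normal_rep_cp N (rho : M -> 'M[C]_N) :
  (forall i, 0 < d i)%N ->
  (forall x y, rho (x * y) = rho x *m rho y) ->
  (forall x, rho (adj x) = adjmx (rho x)) ->
  (forall r s, normal (fun x => rho x r s)) ->
  forall n (X : 'M[M]_n) (w : 'I_n -> 'cV[C]_N), mpos X ->
    0 <= \sum_p \sum_q (adjmx (w p) *m rho (X p q) *m w q) 0 0.
Proof.
move=> d0 rhoM rhoA rhoN n X w Xpos.
pose B (x : M) i := \sum_a \sum_b x i a b *: rho (munit R a b).
have BE x r s : has_sum (fun i => B x i r s) (rho x r s).
  have := normal_has_sum x (rhoN r s); congr has_sum; apply/funext => i.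
  rewrite /blockpart summxE; apply: eq_bigr => a _.
  by rewrite summxE; apply: eq_bigr => b _; rewrite mxE.
have BF x (v u : 'cV[C]_N) : has_sum (fun i => (adjmx v *m B x i *m u) 0 0)
    ((adjmx v *m rho x *m u) 0 0).
  rewrite form_sum; under eq_fun do rewrite form_sum.
  apply: has_sum_sum => r; apply: has_sum_lin => s; exact: BE.
apply: (@has_sum_ge0 _ I
  (fun i => \sum_p \sum_q (adjmx (w p) *m B (X p q) i *m w q) 0 0)).
  move=> i; pose o := Ordinal (d0 i).
  pose y a p := rho (munit R o a) *m w p.
  have formE p q : (adjmx (w p) *m B (X p q) i *m w q) 0 0 =
      \sum_k (adjmx (\col_a y a p k 0) *m X p q i *m (\col_a y a q k 0)) 0 0.
    under [RHS]eq_bigr do rewrite form_sum.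
    rewrite exchange_big mulmx_sumr mulmx_suml summxE; apply: eq_bigr => a _ /=.
    rewrite exchange_big mulmx_sumr mulmx_suml summxE; apply: eq_bigr => b _ /=.
    rewrite -(munitE R o a b) rhoM rhoA -scalemxAr -scalemxAl mxE.
    have -> : adjmx (w p) *m (adjmx (rho (munit R o a)) *m rho (munit R o b)) *m w q
            = adjmx (y a p) *m y b q by rewrite /y adjmxM !mulmxA.
    rewrite mxE mulr_sumr; apply: eq_bigr => k _.
    by rewrite !mxE mulrC.
  under eq_bigr do under eq_bigr do rewrite formE.
  under eq_bigr do rewrite exchange_big.
  rewrite exchange_big; apply: sumr_ge0 => k _ /=.
  exact: (Xpos i (fun p => \col_a y a p k 0)).
by apply: has_sum_sum => p; apply: has_sum_sum => q; exact: BF.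
Qed.

End CompletePositivity.

(** * Positive functionals *)

Section PositiveFunctionals.
Variables (R : realType) (I : choiceType) (d : I -> nat).
Notation C := R[i].
Notation M := (linf R d).

Lemma adjZ (z : C) (x : M) : adj (z *: x) = z^* *: adj x.
Proof. by apply: linfP => i; apply/matrixP => a b; rewrite !mxE rmorphM. Qed.
Lemma adjK (x : M) : adj (adj x) = x.
Proof. by apply: linfP => i; rewrite /= adjmxK. Qed.
Lemma adjM (x y : M) : adj (x * y) = adj y * adj x.
Proof. by apply: linfP => i; rewrite /= adjmxM. Qed.

Lemma form_norm_le n (A : 'M[C]_n) (c : R) (v : 'cV[C]_n) :
  0 <= c -> opnorm_le A c -> `|(adjmx v *m A *m v) 0 0| <= c%:C * sqnorm v.
Proof.
move=> c0 hA; rewrite -(@ler_pXn2r _ 2) ?nnegrE ?normr_ge0 //; last first.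
  by rewrite mulr_ge0 ?realC_ge0 ?sqnorm_ge0.
rewrite -mulmxA; apply: le_trans (dot_sqnorm _ _) _.
have -> : (c%:C * sqnorm v) ^+ 2 = sqnorm v * ((c ^+ 2)%:C * sqnorm v) :> C.
  by rewrite rmorphXn /=; ring.
by rewrite ler_wpM2l ?sqnorm_ge0.
Qed.

Lemma realC2 (c : R) : (2 * c)%:C = 2 * c%:C :> C.
Proof. by rewrite mulr_natl rmorphMn mulr_natl. Qed.

(** Used for [x] and [- x]: the self-adjoint element [x + x^*] lies between
    [- 2c] and [2c]. This is the source of the boundedness of positive
    functionals and of their compatibility with the involution. *)
Lemma lpos_bound_addadj (x : M) (c : R) :
  linf_le x c -> lpos ((2 * c)%:C *: (1 : M) + (x + adj x)).
Proof.
move=> [c0 hx] i v /=.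
rewrite mulmxDr mulmxDl mxE -scalemxAr mulmx1 -scalemxAl mxE -sqnormE.
have h := form_norm_le v c0 (hx i); set z := (_ *m x i *m v) 0 0 in h.
rewrite mulmxDr mulmxDl mxE -/z.
have -> : (adjmx v *m adjmx (x i) *m v) 0 0 = z^*.
  have -> : adjmx v *m adjmx (x i) *m v = adjmx (adjmx v *m x i *m v).
    by rewrite !adjmxM adjmxK mulmxA.
  by rewrite mxE mxE.
have zr : z + z^* \is Num.real by rewrite CrealE rmorphD /= conjCK addrC.
rewrite -lerBlDr sub0r; apply: (@le_trans _ _ `|z + z^*|).
  by rewrite -normrN real_ler_norm // rpredN.
apply: le_trans (ler_normD _ _) _; rewrite norm_conjC.
by rewrite -mulr2n -[X in X <= _]mulr_natl realC2 -mulrA ler_wpM2l.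
Qed.

Variable phi : {scalar M}.
Hypothesis phi_pos : forall x, lpos x -> 0 <= phi x.

Lemma linf_leZ (z : C) (x : M) (c : R) :
  `|z| = 1 -> linf_le x c -> linf_le (z *: x) c.
Proof.
move=> z1 [c0 hx]; split=> // i.
by have := opnorm_leZ z (hx i); rewrite z1 mul1r.
Qed.

Lemma pos_functional_ge (x : M) (c : R) : linf_le x c ->
  0 <= (2 * c)%:C * phi 1 + phi (x + adj x).
Proof. by move=> /lpos_bound_addadj/phi_pos; rewrite linearD linearZ. Qed.

Lemma lpos1 : lpos (1 : M).
Proof. by move=> i v /=; rewrite mulmx1 -sqnormE sqnorm_ge0. Qed.

Lemma pos_functional_real (x : M) : (phi (x + adj x))^* = phi (x + adj x).
Proof.
have [c hx] := linf_bounded x.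
have h1 := pos_functional_ge hx; apply/eqP; rewrite -CrealE.
have p0 : 0 <= (2 * c)%:C * phi 1.
  apply: mulr_ge0; last exact: phi_pos lpos1.
  by rewrite realC_ge0 mulr_ge0 //; case: hx.
by rewrite -[phi _](addKr ((2 * c)%:C * phi 1)) addrC rpredB ?ger0_real.
Qed.

Lemma pos_functional_le (x : M) (c : R) : linf_le x c ->
  `|phi (x + adj x)| <= (2 * c)%:C * phi 1.
Proof.
move=> hx; have h1 := pos_functional_ge hx.
have hN : linf_le (- x) c.
  by rewrite -scaleN1r; apply: linf_leZ => //; rewrite normrN1.
have := pos_functional_ge hN.
have -> : - x + adj (- x) = - (x + adj x).
  by rewrite -[in adj _]scaleN1r adjZ rmorphN rmorph1 scaleN1r opprD.
rewrite linearN subr_ge0 => h2.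
have pr : phi (x + adj x) \is Num.real by rewrite CrealE pos_functional_real.
by rewrite real_ler_norml // h2 andbT -subr_ge0 opprK addrC.
Qed.

(** Cartesian decomposition: [x] is recovered from the self-adjoint elements
    [x + x^*] and [i x + (i x)^*]. *)
Lemma linf_addadj_split (x : M) :
  2 *: x = (x + adj x) - 'i *: ('i *: x + adj ('i *: x)).
Proof.
rewrite adjZ conjCi scalerDr !scalerA mulrN -expr2 sqrCi opprK scale1r scaleN1r.
by rewrite opprD opprK addrACA subrr addr0 scaler_nat mulr2n.
Qed.

Lemma pos_functional_bounded :
  exists K : R, forall x c, linf_le x c -> `|phi x| <= (K * c)%:C.
Proof.
have p1 : phi 1 = (complex.Re (phi 1))%:C.
  by rewrite RRe_real // ger0_real // phi_pos //; exact: lpos1.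
exists (2 * complex.Re (phi 1)) => x c hx.
rewrite -(@ler_pM2l _ 2) // -[X in X * `|_|](normr_nat _ 2) -normrM.
rewrite -linearZ linf_addadj_split linearB [X in _ - X]linearZ.
apply: le_trans (ler_normB _ _) _; rewrite normrM normCi mul1r.
have hi : linf_le ('i *: x) c by apply: linf_leZ; rewrite ?normCi.
have -> : 2 * (2 * complex.Re (phi 1) * c)%:C
    = (2 * c)%:C * phi 1 + (2 * c)%:C * phi 1 :> C.
  by rewrite {2 3}p1 !rmorphM !rmorph_nat; ring.
by apply: lerD; exact: pos_functional_le.
Qed.

Lemma pos_functional_adj (x : M) : phi (adj x) = (phi x)^*.
Proof.
have h2 y : 2 * phi y = phi (2 *: y) by rewrite linearZ.
apply: (@mulfI _ 2); rewrite ?pnatr_eq0 //.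
have -> : 2 * (phi x)^* = (2 * phi x)^* by rewrite rmorphM rmorph_nat.
rewrite !h2 [in RHS]linf_addadj_split linearB [X in _ - X]linearZ.
rewrite rmorphB rmorphM /= !pos_functional_real conjCi.
have -> : 2 *: adj x = (x + adj x) - (- 'i) *: ('i *: x + adj ('i *: x)).
  rewrite adjZ conjCi scalerDr !scalerA mulrN mulNr opprK -expr2 sqrCi opprK.
  by rewrite scale1r scaleN1r opprD opprK addrACA subrr add0r scaler_nat mulr2n.
by rewrite [in LHS]linearB [X in _ - X = _]linearZ.
Qed.

End PositiveFunctionals.

(** * Slice maps *)

Lemma sum_mxtens (V : nmodType) m n (F : 'I_(m * n) -> V) :
  \sum_k F k = \sum_a \sum_b F (mxtens_index (a, b)).
Proof.
rewrite pair_big /= (reindex _ (onW_bij _ (@tens_bij m n))).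
by apply: eq_bigr => -[].
Qed.

Section Slices.
Variables (R : realType) (I J : choiceType) (d : I -> nat) (e : J -> nat).
Notation C := R[i].
Notation M := (linf R d).
Notation N := (linf R e).
Notation MN := (linf R (tdim d e)).

Lemma slice1_entry i (a a' : 'I_(d i)) (X : MN) :
  slice1 (entry R a a') X = coef1 a a' X.
Proof. by apply: linfP => j; apply/matrixP => b b'; rewrite !mxE entryE mxE. Qed.

Lemma slice1_axpy z (f g : dual R d) (X : MN) :
  slice1 (axpy z f g) X = z *: slice1 f X + slice1 g X.
Proof. by apply: linfP => j; apply/matrixP => b b'; rewrite !mxE. Qed.

Lemma coef1_linear i (a a' : 'I_(d i)) : linear (@Defs.coef1 R I J d e i a a').
Proof. by move=> z X Y; apply: linfP => j; apply/matrixP => b b'; rewrite !mxE. Qed.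

Lemma coef1_le i (a a' : 'I_(d i)) (X : MN) c :
  linf_le X c -> linf_le (coef1 a a' X) c.
Proof.
move=> [c0 hX]; split=> // j.
exact: (opnorm_le_entry (@tens_flip_bij _ _) a a' (hX (i, j))).
Qed.

Lemma coef2_le j (b b' : 'I_(e j)) (X : MN) c :
  linf_le X c -> linf_le (coef2 b b' X) c.
Proof.
move=> [c0 hX]; split=> // i.
exact: (opnorm_le_entry (@tens_bij _ _) b b' (hX (i, j))).
Qed.

(** Sharper than the boundedness of the slice: its norm is controlled by the
    norm of the functional, which the density argument requires. The matrix
    coefficient of [(f (x) id) X] at the vectors [v] and [u] is the value of [f]
    at the slice [Y] of [X] by [v] and [u], of norm at most [c |v| |u|]. *)
Lemma slice1_le (f : dual R d) (X : MN) K c :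
  dual_le f K -> linf_le X c -> linf_le (slice1 f X) (K * c).
Proof.
move=> [K0 hK] [c0 hX]; split=> [|j]; first exact: mulr_ge0.
apply: opnorm_le_form => u v.
pose Y : M := \sum_b \sum_b' ((v b 0)^* * u b' 0) *: coef2 b b' X.
have -> : (adjmx v *m slice1 f X j *m u) 0 0 = f Y.
  rewrite form_sum linear_sum; apply: eq_bigr => b _.
  by rewrite linear_sum; apply: eq_bigr => b' _; rewrite linearZ mxE.
apply: (slice_bound c0); apply: hK; split=> [|i].
  by rewrite mulr_ge0 ?sqrtr_ge0.
move=> w; rewrite exprMn sqr_sqrtr ?mulr_ge0 ?Re_sqnorm_ge0 //.
rewrite [X in X * _]rmorphM -[X in _ * X * _]sqnormM_real.
have := sqnorm_slice (@tens_bij _ _) v u w (hX (i, j)).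
congr (sqnorm (_ *m w) <= _); apply/matrixP => a a'; rewrite mxE.
rewrite linf_sumE summxE; apply: eq_bigr => b _.
rewrite linf_sumE summxE; apply: eq_bigr => b' _.
by rewrite !mxE mulrAC.
Qed.

(** The two slices can be exchanged as soon as one of the functionals is normal:
    both sides are bounded and linear in [g], and for an entry functional [g]
    they are equal by definition. *)
Lemma slice_Fubini (g : dual R d) (m : dual R e) (X : MN) :
  normal g -> m (slice1 g X) = g (slice2 m X).
Proof.
move=> ng; apply/eqP; rewrite -subr_eq0; apply/eqP.
have [c hX] := linf_bounded X; have [b hS] := linf_bounded (slice2 m X).
have [K [K0 hK]] := dual_leP m.
apply: (@normal_eq0 _ _ _ (fun g => m (slice1 g X) - g (slice2 m X)) (K * c + b)).
- by case: hX hS => c0 _ [b0 _]; rewrite addr_ge0 ?mulr_ge0.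
- by move=> z f h; rewrite slice1_axpy linearP /= /axpy_fun; ring.
- move=> f k hf; apply: le_trans (ler_normB _ _) _.
  rewrite mulrDl rmorphD; apply: lerD.
    by rewrite -mulrA [c * k]mulrC; apply: hK; exact: slice1_le.
  by rewrite mulrC; apply: (proj2 hf).
- by move=> i a a'; rewrite slice1_entry entryE mxE subrr.
- exact: ng.
Qed.

Lemma tens1_mulE (P : N) (X : MN) i j (a a' : 'I_(d i)) (b b' : 'I_(e j)) :
  (tens 1 P * X) (i, j) (mxtens_index (a, b)) (mxtens_index (a', b')) =
  \sum_k P j b k * X (i, j) (mxtens_index (a, k)) (mxtens_index (a', b')).
Proof.
rewrite mxE (@sum_mxtens _ (d i) (e j)).
rewrite (bigD1 a) //= [X in _ + X]big1 ?addr0 => [|k /negPf ka].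
  by apply: eq_bigr => k _; rewrite tensmxE mxE eqxx mul1r.
by apply: big1 => l _; rewrite tensmxE mxE eq_sym ka !mul0r.
Qed.

Lemma slice1_tens1_mul (f : dual R d) (P : N) (X : MN) :
  slice1 f (tens 1 P * X) = P * slice1 f X.
Proof.
apply: linfP => j; apply/matrixP => b b'; rewrite [RHS]mxE mxE.
have -> : coef2 b b' (tens 1 P * X) = \sum_k P j b k *: coef2 k b' X.
  apply: linfP => i; apply/matrixP => a a'.
  rewrite mxE tens1_mulE linf_sumE summxE; apply: eq_bigr => k _.
  by rewrite !mxE.
rewrite linear_sum; apply: eq_bigr => k _.
by rewrite linearZ mxE.
Qed.

Lemma slice1_tens (f : dual R d) (x : M) (y : N) :
  slice1 f (tens x y) = f x *: y.
Proof.
apply: linfP => j; apply/matrixP => b b'; rewrite [RHS]mxE mxE.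
have -> : coef2 b b' (tens x y) = y j b b' *: x.
  apply: linfP => i; apply/matrixP => a a'; rewrite mxE [RHS]mxE mulrC.
  exact: tensmxE.
by rewrite linearZ mulrC.
Qed.

Lemma coef1_adj i (a a' : 'I_(d i)) (X : MN) :
  coef1 a a' (adj X) = adj (coef1 a' a X).
Proof. by apply: linfP => j; apply/matrixP => b b'; rewrite !mxE. Qed.

End Slices.

(** * The comultiplication and averaging against a functional *)

Lemma mpos_const (R : realType) (I : choiceType) (d : I -> nat) (x : linf R d) :
  lpos x -> mpos (const_mx x : 'M_1).
Proof. by move=> hx i v; rewrite !big_ord1 [const_mx x 0 0]mxE; exact: hx. Qed.

Section Comultiplication.
Variables (R : realType) (G : discrete_quantum_group R).
Notation C := R[i].
Notation d := (@irr_dim R G).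
Notation M := (linf R d).
Notation Delta := (comul G).
Notation eps := (counit G).

Lemma comul_block_normal p r s : normal (fun x : M => Delta x p r s).
Proof. exact: (comul_normal (entry_normal R r s)). Qed.

Lemma comul_cp n (X : 'M[M]_n) : mpos X -> mpos (map_mx Delta X).
Proof.
move=> hX p v.
have XE k l : map_mx Delta X k l = Delta (X k l) by rewrite mxE.
under eq_bigr do under eq_bigr do rewrite XE.
have := @normal_rep_cp _ _ _ _ (fun x => Delta x p) (@dim_gt0 _ G) _ _ _ n X v hX.
apply.
- by move=> x y; rewrite comulM.
- by move=> x; rewrite comul_adj.
- exact: comul_block_normal.
Qed.

Lemma comul_pos (x : M) : lpos x -> lpos (Delta x).
Proof.
move=> /mpos_const/comul_cp hx p v.
by have := hx p (fun=> v); rewrite !big_ord1 !mxE.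
Qed.

(** The counit is a normal representation on 1 x 1 matrices. *)
Lemma counit_pos (x : M) : lpos x -> 0 <= eps x.
Proof.
move=> /mpos_const hx.
have := @normal_rep_cp _ _ _ 1 (fun x => (eps x)%:M) (@dim_gt0 _ G) _ _ _ 1 _
  (fun=> 1%:M) hx.
rewrite !big_ord1 [const_mx x 0 0]mxE mulmx1 /adjmx trmx1 map_mx1 mul1mx.
rewrite [_%:M 0 0]mxE eqxx; apply.
- by move=> y z; rewrite counitM scalar_mxM.
- by move=> y; rewrite counit_adj /adjmx tr_scalar_mx map_scalar_mx.
- move=> r s; rewrite !ord1; under eq_fun do rewrite mxE eqxx.
  exact: counit_normal.
Qed.

(** [c^2 - x^* x] is positive, so its image [c^2 - Delta(x)^* Delta(x)] is. *)
Lemma comul_le (x : M) c : linf_le x c -> linf_le (Delta x) c.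
Proof.
move=> [c0 hx]; split=> // p v.
have : lpos ((c ^+ 2)%:C *: (1 : M) - adj x * x).
  move=> i u /=; rewrite mulmxBr mulmxBl mxE -scalemxAr mulmx1 -scalemxAl mxE.
  rewrite -sqnormE [X in _ + X]mxE subr_ge0.
  rewrite !mulmxA -adjmxM -mulmxA -sqnormE; exact: hx.
move=> /comul_pos/(_ p v).
rewrite linearB linearZ /= comul1 comulM comul_adj /=.
rewrite mulmxBr mulmxBl mxE -scalemxAr mulmx1 -scalemxAl mxE.
rewrite -sqnormE [X in _ + X]mxE subr_ge0.
by rewrite !mulmxA -adjmxM -mulmxA -sqnormE.
Qed.

Section ComulCoef.
Variables (p : irr G * irr G) (r s : 'I_(tdim d d p)).
Definition comul_coef_fun (x : M) : C := Delta x p r s.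
Fact comul_coef_linear : scalar comul_coef_fun.
Proof. by move=> z x y; rewrite /comul_coef_fun linearP /= !mxE. Qed.
HB.instance Definition _ :=
  GRing.isLinear.Build C M C *%R comul_coef_fun comul_coef_linear.
Fact comul_coef_bounded : exists K : R, forall x c,
  linf_le x c -> `|comul_coef_fun x| <= (K * c)%:C.
Proof.
exists 1 => x c /comul_le[c0 hx]; rewrite mul1r.
exact: opnorm_le_mxentry (hx p).
Qed.
Definition comul_coef : dual R d := Dual comul_coef_bounded.
End ComulCoef.

Section Averaging.
Variable m : dual R d.

(** This is [(id (x) m) Delta]. Its defining property is
    [f (average x) = m (x * f)] for normal [f]. *)
Definition average (x : M) : M := slice2 m (Delta x).

Lemma averageE x i a a' : average x i a a' = m (coef1 a a' (Delta x)).
Proof. by rewrite mxE. Qed.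

Fact average_linear : linear average.
Proof.
move=> z x y; apply: linfP => i; apply/matrixP => a a'.
by rewrite [RHS]mxE [X in _ = X + _]mxE !averageE linearP coef1_linear linearP.
Qed.
HB.instance Definition _ := GRing.isLinear.Build C M M *:%R average average_linear.

Lemma average_conv (f : dual R d) x : normal f -> m (modact x f) = f (average x).
Proof. exact: slice_Fubini. Qed.

(** Coassociativity: acting by two entry functionals amounts to acting by their
    convolution, which is an entry of the comultiplication. *)
Lemma modact_entry_entry x i j (a a' : 'I_(d i)) (b b' : 'I_(d j)) :
  modact (modact x (entry R a a')) (entry R b b') =
  modact x (comul_coef (p := (i, j)) (mxtens_index (a, b)) (mxtens_index (a', b'))).
Proof.
rewrite /modact !slice1_entry; apply: linfP => k; apply/matrixP => c c'.
have := comul_coassoc x (i, j, k).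
move=> /matrixP/(_ (mxtens_index (mxtens_index (a, b), c))
                   (mxtens_index (mxtens_index (a', b'), c'))).
rewrite !mxE !mxtens_indexK /= => <-.
by [].
Qed.

(** Compare the entries [(b, b')] of the blocks [j]. Both sides are bounded and
    linear in [f], so [f] may be taken to be an entry functional [w]; with [w']
    the entry functional at [(b, b')], the claim is then
    [m ((x * w) * w') = (w * w') (average x)], which follows from coassociativity
    because [w * w'] is normal. *)
Lemma average_modact (f : dual R d) x :
  normal f -> average (modact x f) = modact (average x) f.
Proof.
move=> nf; apply: linfP => j; apply/matrixP => b b'.
rewrite averageE [RHS]mxE; apply/eqP; rewrite -subr_eq0; apply/eqP.
set y := average x.
have [c hx] := linf_bounded x; have [l hy] := linf_bounded y.
have [K [K0 hK]] := dual_leP m.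
apply: (@normal_eq0 _ _ _ (fun f => m (coef1 b b' (Delta (modact x f))) -
  f (coef2 b b' (Delta y))) (K * c + l)) nf.
- by case: hx hy => c0 _ [l0 _]; rewrite addr_ge0 ?mulr_ge0.
- move=> z f1 f2; rewrite /modact slice1_axpy linearP coef1_linear linearP /=.
  by rewrite /axpy_fun; ring.
- move=> g k hg; apply: le_trans (ler_normB _ _) _.
  rewrite mulrDl rmorphD; apply: lerD.
    rewrite -mulrA [c * k]mulrC; apply: hK; apply: coef1_le; apply: comul_le.
    by apply: slice1_le => //; exact: comul_le.
  by rewrite mulrC; apply: (proj2 hg); apply: coef2_le; exact: comul_le.
- move=> i a a'; rewrite -slice1_entry -/(modact _ _) modact_entry_entry.
  rewrite average_conv; last exact: comul_block_normal.
  by rewrite entryE mxE subrr.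
Qed.

Lemma average1 : m 1 = 1 -> average 1 = 1.
Proof.
move=> m1; apply: linfP => i; apply/matrixP => a a'; rewrite averageE comul1.
have -> : coef1 a a' 1 = (a == a')%:R *: (1 : M).
  apply: linfP => j; apply/matrixP => b b'; rewrite !mxE -natrM mulnb.
  by rewrite (can_eq (@mxtens_indexK _ _)).
by rewrite linearZ m1 /= mulr1 mxE.
Qed.

(** The form of [average X] at the vectors [v p] is the value of [m] at an
    element [z], and the form of [z] at [u] is the form of [Delta X] at the
    vectors [v p (x) u]. *)
Lemma average_cp : (forall x, lpos x -> 0 <= m x) -> completely_positive average.
Proof.
move=> mpos0 n X /comul_cp hX i v.
pose z : M := \sum_p \sum_q \sum_a \sum_a'
  ((v p a 0)^* * v q a' 0) *: coef1 a a' (Delta (X p q)).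
have -> : \sum_p \sum_q (adjmx (v p) *m (map_mx average X) p q i *m v q) 0 0 = m z.
  rewrite linear_sum; apply: eq_bigr => p _; rewrite linear_sum.
  apply: eq_bigr => q _; rewrite form_sum linear_sum; apply: eq_bigr => a _.
  rewrite linear_sum; apply: eq_bigr => a' _.
  by rewrite linearZ mxE averageE.
apply: mpos0 => j u.
pose w p : 'cV[C]_(tdim d d (i, j)) := \col_k
  (v p (mxtens_unindex k).1 0 * u (mxtens_unindex k).2 0).
have := hX (i, j) w; congr (0 <= _).
have -> : z j = \sum_p \sum_q \sum_a \sum_a'
    ((v p a 0)^* * v q a' 0) *: coef1 a a' (Delta (X p q)) j.
  rewrite linf_sumE; apply: eq_bigr => p _; rewrite linf_sumE.
  apply: eq_bigr => q _; rewrite linf_sumE; apply: eq_bigr => a _.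
  by rewrite linf_sumE; apply: eq_bigr => a' _.
rewrite mulmx_sumr mulmx_suml summxE; apply: eq_bigr => p _.
rewrite mulmx_sumr mulmx_suml summxE; apply: eq_bigr => q _.
rewrite form_sum (@sum_mxtens _ (d i) (d j)).
rewrite mulmx_sumr mulmx_suml summxE; apply: eq_bigr => a _.
rewrite mulmx_sumr mulmx_suml summxE.
under eq_bigr => b _.
  rewrite (@sum_mxtens _ (d i) (d j)).
  over.
rewrite exchange_big; apply: eq_bigr => a' _ /=.
rewrite -scalemxAr -scalemxAl [RHS]mxE form_sum mulr_sumr; apply: eq_bigr => b _.
rewrite mulr_sumr; apply: eq_bigr => b' _.
rewrite !mxE !mxtens_indexK /= rmorphM; ring.
Qed.

End Averaging.
End Comultiplication.

(** * Relative amenability and invariant states *)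

Section Invariance.
Variables (R : realType) (G : discrete_quantum_group R).
Notation C := R[i].
Notation d := (@irr_dim R G).
Notation M := (linf R d).
Variable P : M.

(** Slice the equation that defines [Ntilde P] with the counit on the left. *)
Lemma Ntilde_mul (y : M) : Ntilde P y -> P * y = counit G y *: P.
Proof.
move=> yN; rewrite -[in LHS](counitl y) -slice1_tens1_mul yN.
exact: slice1_tens.
Qed.

(** The state is the counit composed with [E]. For [y = E x] in [Ntilde P],
    [counit (y * (f P)) = f (P y) = counit y * f P] by [Ntilde_mul]. *)
Lemma amenable_invariant :
  relatively_amenable (Ntilde P) -> exists m, state m /\ left_invariant P m.
Proof.
move=> [E [E1 Ecp Emod EN]].
have Epos x : lpos x -> lpos (E x).
  move=> /mpos_const/Ecp hx i v; have := hx i (fun=> v).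
  by rewrite !big_ord1 !mxE.
pose phi : {scalar M} := (counit G \o E)%FUN.
have phi_pos x : lpos x -> 0 <= phi x by move=> /Epos; exact: counit_pos.
exists (Dual (pos_functional_bounded phi_pos)); split.
  by split=> //=; rewrite E1 counit1.
left=> f nf x; rewrite /conv /= Emod; last exact: normal_ract.
rewrite /modact slice_Fubini; last exact: normal_ract.
by rewrite counitr /= /ract_fun Ntilde_mul // linearZ mulrC.
Qed.

Section FromInvariantState.
Variable m : dual R d.
Hypothesis m_state : state m.
Let m_pos : forall x, lpos x -> 0 <= m x := proj1 m_state.

Lemma average_adj x : average m (adj x) = adj (average m x).
Proof.
apply: linfP => i; apply/matrixP => a a'.
rewrite averageE comul_adj coef1_adj (pos_functional_adj m_pos).
have -> : adj (average m x) i a a' = (average m x i a' a)^* by rewrite mxE mxE.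
by rewrite averageE.
Qed.

(** Left invariance tested on entry functionals. The first form of invariance
    says [f (P * average x) = m x * f P] for all such [f]. The second one gives
    [average x * P = m x *: P], and taking adjoints exchanges the two. *)
Lemma left_invariant_mul x : adj P = P -> left_invariant P m ->
  P * average m x = m x *: P.
Proof.
move=> PA [] h.
  apply: linfP => i; apply/matrixP => a a'; have ne := entry_normal R a a'.
  have := h _ ne x; rewrite /conv average_conv; last exact: normal_ract.
  by move=> /= e; rewrite [LHS]e mxE mulrC.
have hr y : average m y * P = m y *: P.
  apply: linfP => i; apply/matrixP => a a'; have ne := entry_normal R a a'.
  have := h _ ne y; rewrite /conv average_conv; last exact: normal_lact.
  by move=> /= e; rewrite [LHS]e mxE mulrC.
rewrite -[average m x]adjK -average_adj -{1}PA -adjM hr adjZ PA.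
by rewrite (pos_functional_adj m_pos) conjCK.
Qed.

(** Slicing the first leg of [(1 (x) P) Delta(average x)] by an entry functional
    [w] gives [P (average x * w) = P average (x * w)], which is [m (x * w) P] by
    [left_invariant_mul], that is [w (average x) P]. *)
Lemma average_Ntilde x : adj P = P -> left_invariant P m ->
  Ntilde P (average m x).
Proof.
move=> PA mP; rewrite /Ntilde /=; apply: linfP => -[i j]; apply/matrixP => r s.
rewrite -(@mxtens_unindexK (d i) (d j) r) -(@mxtens_unindexK (d i) (d j) s).
case: (mxtens_unindex r) => a b; case: (mxtens_unindex s) => a' b'.
rewrite tens1_mulE.
have -> : \sum_k P j b k * comul G (average m x) (i, j)
    (mxtens_index (a, k)) (mxtens_index (a', b')) =
    (P * modact (average m x) (entry R a a')) j b b'.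
  by rewrite mxE /modact slice1_entry; apply: eq_bigr => k _; rewrite [in RHS]mxE.
rewrite -average_modact; last exact: entry_normal.
rewrite left_invariant_mul // mxE /modact slice1_entry -averageE.
by rewrite [RHS]tensmxE.
Qed.

Lemma invariant_amenable : adj P = P -> left_invariant P m ->
  relatively_amenable (Ntilde P).
Proof.
move=> PA mP; exists (average m : {linear M -> M}); split.
- by apply: average1; case: m_state.
- exact: average_cp.
- by move=> x f; exact: average_modact.
- by move=> x; exact: average_Ntilde.
Qed.

End FromInvariantState.
End Invariance.

Theorem theorem3p4 (R : realType) (G : discrete_quantum_group R)
    (P : linf R (@irr_dim R G)) :
  group_like_projection P ->
  (relatively_amenable (Ntilde P) <->
   exists m : dual R (@irr_dim R G), state m /\ left_invariant P m).
Proof.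
move=> [PA _ _]; split; first exact: amenable_invariant.
by move=> [m [ms mP]]; exact: (invariant_amenable ms PA mP).
Qed.
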